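(* Let $t_0\in\mathbb{R}$, let $\ell_0,\ell_1,f\in V$ be such that $\ell_0-\ell_1\in\mathcal{P}^+_{t_0}$, suppose $f(0)(t)=0$ for a.e. $t\le t_0$, and let there exist $\kappa>0$ such that: (i) $f(v)(t)\ge 0$ for a.e. $t\le t_0$ and every $v\in C_0(\mathbb{R};[0,\kappa])$; (ii) $f(v)(t)\,\operatorname{sgn} v(t)\le q(t,\|v\|)$ for a.e. $t\ge t_0$ and every $v\in C_0(\mathbb{R};\mathbb{R})$ with $0\le v(t_0)\le\kappa$ and $-\kappa\le v(t)\le\kappa$ for $t\le t_0$, where $q\in K_{loc}([t_0,+\infty)\times\mathbb{R}_+;\mathbb{R}_+)$ is nondecreasing in the second argument and satisfies $\lim_{x\to+\infty}\frac1x\int_{t_0}^b q(s,x)\,ds=0$ for every $b>t_0$. Then, for every $c\in[0,\kappa]$, there exists a global solution $u$ to $u'(t)=\ell_0(u)(t)-\ell_1(u)(t)+f(u)(t)$, $u(t_0)=c$, satisfying $0\le u(t)\le\kappa$ for $t\le t_0$ and $u'(t)\ge0$ for a.e. $t\le t_0$.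
   Context: Notation. $\mathbb{R}_+=[0,+\infty)$. $C_{loc}(\mathbb{R};\mathbb{R})$ is the space of continuous functions $\mathbb{R}\to\mathbb{R}$ with the topology of uniform convergence on every compact interval. $L_{loc}(\mathbb{R};\mathbb{R})$ is the space of locally Lebesgue-integrable functions on $\mathbb{R}$ with the topology of convergence in the mean on every compact interval. For $I,D\subseteq\mathbb{R}$: $C_0(I;D)$ is the set of bounded continuous functions $I\to D$; $AC_{loc}(I;D)$ is the set of functions $I\to D$ absolutely continuous on every compact interval contained in $I$; $L_{loc}(I;\mathbb{R}_+)$ is the set of functions $I\to\mathbb{R}_+$ integrable on every compact interval contained in $I$. $\|v\|=\sup\{|v(t)|:t\in\mathbb{R}\}$. $\operatorname{sgn}$ is the sign function with $\operatorname{sgn}0=0$. $K_{loc}([t_0,+\infty)\times\mathbb{R}_+;\mathbb{R}_+)$ is the set of functions $q:[t_0,+\infty)\times\mathbb{R}_+\to\mathbb{R}_+$ such that $q(\cdot,x)$ is measurable for every $x$, $q(t,\cdot)$ is continuous for a.e. $t$, and for every compact $D\subset\mathbb{R}_+$ the function $\sup\{q(\cdot,x):x\in D\}$ is integrable on every compact subinterval of $[t_0,+\infty)$. Standing assumptions. $\ell_0,\ell_1:C_{loc}(\mathbb{R};\mathbb{R})\to L_{loc}(\mathbb{R};\mathbb{R})$ are linear continuous operators which are positive (map non-negative functions to non-negative functions). $f:C_{loc}(\mathbb{R};\mathbb{R})\to L_{loc}(\mathbb{R};\mathbb{R})$ is a continuous operator satisfying the local Carathéodory conditions: for every $r>0$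 there is $q_r\in L_{loc}(\mathbb{R};\mathbb{R}_+)$ with $|f(v)(t)|\le q_r(t)$ for a.e. $t\in\mathbb{R}$ whenever $\sup_{\mathbb{R}}|v|\le r$. If $I\subseteq\mathbb{R}$ is a closed interval, $u:I\to\mathbb{R}$ is continuous and $T:C_{loc}(\mathbb{R};\mathbb{R})\to L_{loc}(\mathbb{R};\mathbb{R})$ is a continuous operator, then $T(u):=T(\vartheta(u))$, where $\vartheta(u)$ is the extension of $u$ to $\mathbb{R}$ equal to $u(\inf I)$ to the left of $I$ (if $\inf I>-\infty$) and $u(\sup I)$ to the right of $I$ (if $\sup I<+\infty$). $T(0)$ is the value of $T$ at the zero function. For $\tau\in\mathbb{R}$, $V_\tau$ is the set of continuous operators $T:C_{loc}(\mathbb{R};\mathbb{R})\to L_{loc}(\mathbb{R};\mathbb{R})$ such that for every $\zeta\le\tau$, $T(u)(t)=T(v)(t)$ for a.e. $t\le\zeta$ whenever $u,v\in C_{loc}(\mathbb{R};\mathbb{R})$ and $u=v$ on $(-\infty,\zeta]$. $V=\bigcap_{\tau\in\mathbb{R}}V_\tau$. $\mathcal{P}^+_\tau$ is the set of linear continuous operators $\ell:C_{loc}(\mathbb{R};\mathbb{R})\to L_{loc}(\mathbb{R};\mathbb{R})$ such that $\ell(u)(t)\ge0$ for a.e. $t\le\tau$ whenever $u\in AC_{loc}((-\infty,\tau];\mathbb{R}_+)$ is nondecreasing. A global solution is a function $u:\mathbb{R}\to\mathbb{R}$ absolutely continuous on every compact interval and satisfying the equation for a.e. $t\in\mathbb{R}$.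 *)

(* Defs.v *)
From HB Require Import structures.
From mathcomp Require Import all_boot all_order all_algebra.
From mathcomp Require Import all_classical all_reals all_analysis.

Set Implicit Arguments.
Unset Strict Implicit.
Unset Printing Implicit Defensive.

Import Order.TTheory GRing.Theory Num.Theory.
Import numFieldNormedType.Exports.

Local Open Scope classical_set_scope.
Local Open Scope ring_scope.

Section FunctionSpaces.
Context {R : realType}.
Local Notation mu := (@lebesgue_measure R).

Definition C_loc : set (R -> R) := [set u | continuous u].

(* An element of this space is a class modulo a.e. equality, given here by a
   Borel representative; only a.e. statements are made about it. *)
Definition L_loc : set (R -> R) := [set g | locally_integrable setT g].

Definition C_0 (D : set R) : set (R -> R) :=
  [set v | [/\ continuous v, [bounded v t | t in [set: R]] &
               forall t, D (v t)]].

Definition supnorm (v : R -> R) : R := sup [set `|v t| | t in [set: R]].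

(* A finite family of non-overlapping subintervals [s i, s' i] of [a, b] is
   given by its endpoints; degenerate intervals contribute 0 to both sums. *)
Definition absolutely_continuous (a b : R) (u : R -> R) : Prop :=
  forall e : R, 0 < e -> exists2 d : R, 0 < d &
    forall (n : nat) (s s' : 'I_n -> R),
      (forall i, [/\ a <= s i, s i <= s' i & s' i <= b]) ->
      (forall i j, i != j -> s' i <= s j \/ s' j <= s i) ->
      \sum_(i < n) (s' i - s i) < d ->
      \sum_(i < n) `|u (s' i) - u (s i)| < e.

(* A function I -> R is given by a total function whose values outside I play
   no role. *)
Definition AC_loc (I : set R) : set (R -> R) :=
  [set u | forall a b, a <= b -> `[a, b] `<=` I -> absolutely_continuous a b u].

(* [q] is a function on [t0, +oo[ x [0, +oo[; its values elsewhere play no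
   role. Measurability and integrability are meant in the sense of Lebesgue
   (not Borel), hence the completed measure. [D] is nonempty because the
   supremum over the empty set is -oo in \bar R. *)
Definition K_loc (t0 : R) (q : R -> R -> R) : Prop :=
  [/\ forall t x, t0 <= t -> 0 <= x -> 0 <= q t x,
      forall x, 0 <= x ->
        measurable_fun (T := caratheodory_type (wlength idfun)^*%mu)
          `[t0, +oo[ (q ^~ x),
      {ae mu, forall t, t0 <= t -> {within `[0, +oo[, continuous (q t)}} &
      forall D : set R, compact D -> D !=set0 -> D `<=` `[0, +oo[ ->
        forall a b, t0 <= a -> a <= b ->
          (@completed_lebesgue_measure R).-integrable `[a, b]
            (fun t => ereal_sup [set (q t x)%:E | x in D])].

End FunctionSpaces.

(* An operator C_loc -> L_loc is a map on all functions of which only the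
   values at continuous functions matter. *)
Section Operators.
Context {R : realType}.
Local Notation mu := (@lebesgue_measure R).
Implicit Types T l : (R -> R) -> R -> R.

Definition continuous_operator T : Prop :=
  (forall u, C_loc u -> L_loc (T u)) /\
  (forall u, C_loc u -> forall a b : R,
     (\int[mu]_(t in `[a, b]) `|T v t - T u t|%:E)%E
       @[v --> within C_loc (nbhs (u : {family compact, R -> R}))] --> 0%E).

Definition linear_operator T : Prop :=
  forall (k : R) u v, C_loc u -> C_loc v ->
    {ae mu, forall t, T (fun s => k * u s + v s) t = k * T u t + T v t}.

Definition positive_operator T : Prop :=
  forall u, C_loc u -> (forall t, 0 <= u t) -> {ae mu, forall t, 0 <= T u t}.

Definition local_caratheodory T : Prop :=
  forall r : R, 0 < r ->
    exists q_r, [/\ L_loc q_r, forall t, 0 <= q_r t &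
      forall v, C_loc v -> (forall t, `|v t| <= r) ->
        {ae mu, forall t, `|T v t| <= q_r t}].

Definition V_ (tau : R) T : Prop :=
  continuous_operator T /\
  forall zeta, zeta <= tau -> forall u v, C_loc u -> C_loc v ->
    (forall t, t <= zeta -> u t = v t) ->
    {ae mu, forall t, t <= zeta -> T u t = T v t}.

Definition V T : Prop := forall tau, V_ tau T.

(* The extension of u : ]-oo, tau] -> R by the constant u tau. *)
Definition extend_right (tau : R) (u : R -> R) : R -> R :=
  fun t => u (Num.min t tau).

Definition P_plus (tau : R) l : Prop :=
  [/\ continuous_operator l, linear_operator l &
      forall u, AC_loc `]-oo, tau] u -> (forall t, t <= tau -> 0 <= u t) ->
        {in `]-oo, tau] &, nondecreasing_fun u} ->
        {ae mu, forall t, t <= tau -> 0 <= l (extend_right tau u) t}].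

Definition global_solution (F : (R -> R) -> R -> R) (u : R -> R) : Prop :=
  AC_loc setT u /\
  {ae mu, forall t, derivable u t 1 /\ derive1 u t = F u t}.

End Operators.

(* Main.v *)
Require Import Defs.
From mathcomp Require Import all_boot all_order all_algebra.
From mathcomp Require Import all_classical all_reals all_analysis.
From mathcomp Require Import measurable_realfun ring lra.
Import Order.TTheory GRing.Theory Num.Theory.
Import numFieldNormedType.Exports.
Local Open Scope classical_set_scope.
Local Open Scope ring_scope.

(** All operators are causal, so write the equation as u' = h(u) with
   h = l0 - l1 + f and solve it in the integrated form
   u t - u s = H t - H s, where H = prim (h u) is a primitive of h u.

   A fixed-point theorem is avoided thanks to causality. For a delay d > 0 and
   an initial time a, the retarded problem
   v t = y + (integral of h v from a to max a (t - d))
   is solved by finitely many iterations from the constant y, since each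
   iteration settles the solution on a further stretch of length d; the
   result depends continuously on y. On the past of t0 the right-hand side is
   nonnegative along nondecreasing functions with values in [0, kappa] and
   vanishes along 0, so y = 0 gives the value 0 at t0 while y = kappa gives a
   value at least kappa. By the intermediate value theorem some y gives the
   value c: the condition at t0 is met by shooting from the left
   (tonelli_shooting). Letting a tend to -oo and d to 0, an Arzela-Ascoli
   argument (limit_of_approximations) yields a solution that is nondecreasing
   and between 0 and kappa on the past of t0.

   This is carried out for h composed with a truncation of its argument at a
   level B, which makes the right-hand side bounded by a fixed locally
   integrable function. The truncation is harmless as long as the solution
   stays below B. The sign condition on f and the sublinearity of q give a
   bound on each interval up to b that holds for every such solution
   (apriori_bound): between the last time at which |u| equals r and the first
   time at which it equals x > 2 r, |u| can grow only by
   x (integral of l0 1 + l1 1) + (integral of q( . , x)), and each of the two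
   terms is at most x / 4 over a short interval, resp. for large x. Truncating
   at higher and higher levels and applying limit_of_approximations once more,
   now without delay, gives the global solution (global_existence). *)

(** * Locally integrable functions and almost everywhere inequalities *)

Section LocallyIntegrable.
Context {R : realType}.
Local Notation mu := (@lebesgue_measure R).
Implicit Types (g : R -> R) (a b s t : R).

Lemma ae_imply (P Q : R -> Prop) : (forall t, P t -> Q t) ->
  {ae mu, forall t, P t} -> {ae mu, forall t, Q t}.
Proof.
by move=> PQ; apply: (@filterS _ _ (ae_filter_ringOfSetsType mu)).
Qed.

Lemma ae_imply2 (P Q S : R -> Prop) : (forall t, P t -> Q t -> S t) ->
  {ae mu, forall t, P t} -> {ae mu, forall t, Q t} ->
  {ae mu, forall t, S t}.
Proof.
by move=> PQS; apply: (@filterS2 _ _ (ae_filter_ringOfSetsType mu)).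
Qed.

Lemma ae_imply3 (P Q S S' : R -> Prop) :
  (forall t, P t -> Q t -> S t -> S' t) ->
  {ae mu, forall t, P t} -> {ae mu, forall t, Q t} ->
  {ae mu, forall t, S t} -> {ae mu, forall t, S' t}.
Proof.
by move=> PQS; apply: (@filterS3 _ _ (ae_filter_ringOfSetsType mu)).
Qed.

Lemma L_loc_measurable g : L_loc g -> measurable_fun setT g.
Proof. by case. Qed.

Lemma L_loc_integrable g a b : L_loc g -> mu.-integrable `[a, b] (EFin \o g).
Proof.
move=> [mg _ ig]; apply/integrableP; split.
  by apply/measurable_EFinP; apply: measurable_funTS.
by apply: ig => //; exact: segment_compact.
Qed.

Lemma L_loc_integrableS g (A : set (measurableTypeR R)) a b :
  L_loc g -> measurable A -> A `<=` `[a, b] -> mu.-integrable A (EFin \o g).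
Proof.
move=> gL mA AB; by apply: integrableS AB (L_loc_integrable g a b gL).
Qed.

Lemma L_locD g g' : L_loc g -> L_loc g' -> L_loc (fun t => g t + g' t).
Proof. exact: locally_integrableD. Qed.

Lemma L_locB g g' : L_loc g -> L_loc g' -> L_loc (fun t => g t - g' t).
Proof. exact: locally_integrableB. Qed.

Lemma L_locN g : L_loc g -> L_loc (fun t => - g t).
Proof. exact: locally_integrableN. Qed.

Lemma L_loc_norm g : L_loc g -> L_loc (fun t => `|g t|).
Proof.
move=> [mg oT ig]; split => //; first exact: measurableT_comp.
by move=> K KT cK; under eq_integral do rewrite normr_id; exact: ig.
Qed.

Lemma ae_le_Rintegral (A : set (measurableTypeR R)) g g' : measurable A ->
  mu.-integrable A (EFin \o g) -> mu.-integrable A (EFin \o g') ->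
  {ae mu, forall t, A t -> g t <= g' t} ->
  \int[mu]_(t in A) g t <= \int[mu]_(t in A) g' t.
Proof.
move=> mA ig ig' gg'; rewrite -subr_ge0 -RintegralB//.
pose k t := g' t - g t.
have ik : mu.-integrable A (EFin \o k).
  rewrite (_ : _ \o _ = ((EFin \o g') \- (EFin \o g))%E)//.
  exact: integrableB.
have mk : measurable_fun A (EFin \o k) by case/integrableP : ik.
have -> : \int[mu]_(t in A) k t = \int[mu]_(t in A) `|k t|.
  congr fine; apply: (@ae_eq_integral _ _ _ mu) => //.
    apply/measurable_EFinP; apply: measurableT_comp => //.
    exact/measurable_EFinP.
  by apply: ae_imply gg' => t /[apply] gt /=; rewrite ger0_norm// subr_ge0.
by apply: fine_ge0; apply: integral_ge0 => t _; rewrite lee_fin.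
Qed.

End LocallyIntegrable.

(** * Primitives of locally integrable functions *)

Section Primitive.
Context {R : realType}.
Local Notation mu := (@lebesgue_measure R).
Implicit Types (g : R -> R) (a b s t : R).

(** At most one of the two intervals is nondegenerate, so this is the signed
   integral of g from 0 to t for both signs of t. *)
Definition prim g t : R :=
  \int[mu]_(x in `[0, t]) g x - \int[mu]_(x in `[t, 0]) g x.

Lemma Rintegral_itvD g a b s : L_loc g -> a <= s -> s <= b ->
  \int[mu]_(x in `[a, b]) g x =
  \int[mu]_(x in `[a, s]) g x + \int[mu]_(x in `[s, b]) g x.
Proof.
move=> gL as_ sb.
have H := @Rintegral_itvB R g (BLeft a) (BRight b) s
  (L_loc_integrable g a b gL).
rewrite !bnd_simp in H; move: (H as_ sb) => /eqP.
rewrite subr_eq addrC => /eqP ->; congr (_ + _).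
apply: Rintegral_itv_obnd_cbnd.
apply: (L_loc_integrableS g _ s b) => //; exact: subset_itv_oc_cc.
Qed.

Lemma Rintegral_itv_ge g a b : b <= a -> \int[mu]_(x in `[a, b]) g x = 0.
Proof.
rewrite le_eqVlt => /predU1P[->|ba]; first by rewrite set_itv1 Rintegral_set1.
by rewrite set_itv_ge ?bnd_simp -?ltNge// Rintegral_set0.
Qed.

Lemma prim_diff g s t : L_loc g -> s <= t ->
  prim g t - prim g s = \int[mu]_(x in `[s, t]) g x.
Proof.
move=> gL st; rewrite /prim.
have [s0|s0] := leP 0 s.
  have t0 := le_trans s0 st.
  rewrite (Rintegral_itv_ge g t 0)// (Rintegral_itv_ge g s 0)//.
  by rewrite (Rintegral_itvD g 0 t s)// !subr0 addrC addKr.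
rewrite (Rintegral_itv_ge g 0 s) ?ltW//.
have [t0|t0] := leP 0 t.
  by rewrite (Rintegral_itv_ge g t 0)// (Rintegral_itvD g s t 0) ?(ltW s0)//
    subr0 sub0r opprK addrC.
by rewrite (Rintegral_itv_ge g 0 t) ?(ltW t0)//
  (Rintegral_itvD g s 0 t) ?(ltW t0)// !sub0r opprK addrC addrK.
Qed.

Lemma prim_le g g' s t : L_loc g -> L_loc g' -> s <= t ->
  {ae mu, forall x, s <= x <= t -> g x <= g' x} ->
  prim g t - prim g s <= prim g' t - prim g' s.
Proof.
move=> gL gL' st gg'; rewrite !prim_diff//.
apply: ae_le_Rintegral; first exact: measurable_itv.
- exact: L_loc_integrable.
- exact: L_loc_integrable.
- by apply: ae_imply gg' => x; rewrite /= in_itv.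
Qed.

Lemma prim_eq g g' s t : L_loc g -> L_loc g' -> s <= t ->
  {ae mu, forall x, s <= x <= t -> g x = g' x} ->
  prim g t - prim g s = prim g' t - prim g' s.
Proof.
move=> gL gL' st gg'; apply/eqP; rewrite eq_le; apply/andP; split;
 by apply: prim_le => //; apply: ae_imply gg' => x /[apply] ->.
Qed.

Lemma prim0 t : prim (fun=> 0) t = 0.
Proof. by rewrite /prim /Rintegral !integral0 subrr. Qed.

Lemma L_loc0 : L_loc (fun=> 0 : R).
Proof.
split => //; first exact: openT.
by move=> K _ _; under eq_integral do rewrite normr0; rewrite integral0.
Qed.

Lemma prim_ge0 g s t : L_loc g -> s <= t ->
  {ae mu, forall x, s <= x <= t -> 0 <= g x} -> prim g s <= prim g t.
Proof.
move=> gL st g0; have := prim_le _ g s t L_loc0 gL st g0.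
by rewrite !prim0 subrr subr_ge0.
Qed.

Lemma prim_norm g G s t : L_loc g -> L_loc G -> s <= t ->
  {ae mu, forall x, s <= x <= t -> `|g x| <= G x} ->
  `|prim g t - prim g s| <= prim G t - prim G s.
Proof.
move=> gL GL st gG; rewrite [leRHS]prim_diff// prim_diff//.
have ig := L_loc_integrable g s t gL.
apply: le_trans (le_normr_Rintegral _ ig) _ => //.
rewrite -!prim_diff//; last exact: L_loc_norm.
by apply: prim_le => //; exact: L_loc_norm.
Qed.

(** The bound is uniform in s and t: it turns convergence in the mean of the
   right-hand sides into uniform convergence of the increments. *)
Lemma prim_dist g g' a b s t : L_loc g -> L_loc g' ->
  a <= s -> s <= t -> t <= b ->
  `|(prim g t - prim g s) - (prim g' t - prim g' s)| <=
  \int[mu]_(x in `[a, b]) `|g x - g' x|.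
Proof.
move=> gL gL' as_ st tb.
have dL := L_locB _ _ gL gL'.
have -> : (prim g t - prim g s) - (prim g' t - prim g' s) =
  \int[mu]_(x in `[s, t]) (g x - g' x).
  rewrite !prim_diff// RintegralB//; exact: L_loc_integrable.
have ig := L_loc_integrable _ s t dL.
apply: le_trans (le_normr_Rintegral _ ig) _ => //.
have nL := L_loc_norm _ dL.
rewrite (Rintegral_itvD _ a b s)//; last exact: le_trans tb.
rewrite (Rintegral_itvD _ s b t)//.
have I0 c d : 0 <= \int[mu]_(x in `[c, d]) `|g x - g' x|.
  exact: Rintegral_ge0.
by rewrite addrCA lerDl addr_ge0.
Qed.

End Primitive.

(** * Absolute continuity of primitives *)

Section PrimitiveRegularity.
Context {R : realType}.
Local Notation mu := (@lebesgue_measure R).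
Implicit Types (g : R -> R) (a b s t : R).

(** Split g as k + (g - k) with k continuous and g - k small in the mean: the
   integral of k over A is controlled by the bound of k on [a, b] and the
   measure of A. *)
Lemma Rintegral_uniformly_small g a b : L_loc g -> forall e : R, 0 < e ->
  exists2 d : R, 0 < d & forall A : set (measurableTypeR R), measurable A ->
    A `<=` `[a, b] -> (mu A < d%:E)%E -> \int[mu]_(t in A) `|g t| < e.
Proof.
move=> gL e e0.
have ig := L_loc_integrable g a b gL.
have fin : (mu `[a, b] < +oo)%E.
  by rewrite lebesgue_measure_itv /=; case: ifP => // _; rewrite ltry.
have [g_ [gc gi]] :=
  approximation_continuous_integrable (measurable_itv `[a, b]) fin ig.
have e2 : 0 < e / 2 by rewrite divr_gt0.
move/fine_cvgP => -[finI /cvgrPdist_lt/(_ _ e2)] [n _ Hn].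
case: finI => m _ finI.
pose k := g_ (maxn n m).
have kc : continuous k := gc _.
have gkL : L_loc k.
  split; [|exact: openT|].
    exact: continuous_measurable_fun.
  move=> K _ cK.
  have kK : {within K, continuous k} by exact: continuous_subspaceT.
  by have /integrableP[] := continuous_compact_integrable cK kK.
have dL := L_loc_norm _ (L_locB _ _ gL gkL).
have Ik : \int[mu]_(t in `[a, b]) `|g t - k t| < e / 2.
  have := Hn (maxn n m) (leq_maxl _ _); rewrite /= sub0r normrN.
  by apply: le_lt_trans; apply: ler_norm.
have [M [M0 HM]] : exists M : R, 0 < M /\ forall t, a <= t <= b -> `|k t| <= M.
  have [//|M [_ HM]] := @compact_bounded R R^o (k @` `[a, b]).
    apply: continuous_compact; last exact: segment_compact.
    exact: continuous_subspaceT.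
  exists (Num.max 1 (M + 1)); split; first by rewrite lt_max ltr01.
  move=> t tab; apply: (HM (Num.max 1 (M + 1))).
    by rewrite lt_max ltrDl ltr01 orbT.
  by exists t => //; rewrite /= in_itv.
exists (e / 2 / M); first by rewrite divr_gt0.
move=> A mA Aab muA.
have ikA := L_loc_integrableS _ A a b dL mA Aab.
have icA : mu.-integrable A (EFin \o cst M).
  apply: measurable_bounded_integrable => //.
    by apply: lt_trans muA _; rewrite ltry.
  exact: bounded_cst.
apply: (@le_lt_trans _ _ (\int[mu]_(t in A) (`|g t - k t| + M))).
  apply: le_Rintegral => //.
  - exact: L_loc_integrableS (L_loc_norm _ gL) mA Aab.
  - exact: (integrableD mA ikA icA).
  - move=> t /Aab; rewrite /= in_itv => /HM kM.
    rewrite -[X in `|X|](subrK (k t)); apply: le_trans (ler_normD _ _) _.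
    exact: lerD.
rewrite RintegralD// Rintegral_cst// (splitr e); apply: ltrD.
  apply: le_lt_trans Ik; rewrite fine_le//.
  - exact: integrable_fin_num.
  - by apply: integrable_fin_num; [|exact: L_loc_integrable].
  - apply: ge0_subset_integral => //.
    by have /integrableP[] := L_loc_integrable _ a b dL.
rewrite mulrC -ltr_pdivlMr// -lte_fin fineK//.
by rewrite ge0_fin_numE// (lt_trans muA)// ltry.
Qed.

Lemma AC_prim g : L_loc g -> AC_loc setT (prim g).
Proof.
move=> gL a b ab _ e e0.
have [d d0 Hd] := Rintegral_uniformly_small _ a b gL e e0.
exists d => // n s s' sab disj sd.
(* Half-open intervals: non-overlapping closed ones may share an endpoint. *)
pose F (i : 'I_n) : set (measurableTypeR R) := `]s i, s' i]%classic.
have mF i : measurable (F i) by exact: measurable_itv.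
have tF : trivIset setT F.
  apply/trivIsetP => i j _ _ ij; rewrite -subset0 => x [].
  rewrite /F /= !in_itv /= => /andP[six xsi] /andP[sjx xsj].
  case: (disj i j ij) => [le1|le1].
    by move: (lt_le_trans sjx xsi); rewrite ltNge le1.
  by move: (lt_le_trans six xsj); rewrite ltNge le1.
pose A := \big[setU/set0]_(i < n) F i.
have mA : measurable A by exact: bigsetU_measurable.
have Aab : A `<=` `[a, b].
  apply: (big_ind (fun B => B `<=` `[a, b])) => //.
    by move=> B B' Bab B'ab x [/Bab|/B'ab].
  move=> i _ x; have [asi sis s'b] := sab i.
  rewrite /F /= !in_itv /= => /andP[six xsi].
  by rewrite (le_trans asi (ltW six)) (le_trans xsi s'b).
have muA : (mu A < d%:E)%E.
  rewrite measure_bigsetU_ord//.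
  apply: le_lt_trans (_ : (_ <= (\sum_(i < n) (s' i - s i))%:E)%E) _.
    rewrite -sumEFin; apply: lee_sum => i _.
    change (mu (F i) <= (s' i - s i)%:E)%E.
    have -> : mu (F i) = _ := lebesgue_measure_itv `]s i, s' i].
    rewrite /=; case: ifP => // _.
    by rewrite lee_fin subr_ge0; have [] := sab i.
  by rewrite lte_fin.
apply: le_lt_trans (Hd A mA Aab muA).
have nL := L_loc_norm _ gL.
have -> : \int[mu]_(t in A) `|g t| = \sum_(i < n) \int[mu]_(t in F i) `|g t|.
  have iA := L_loc_integrableS _ A a b nL mA Aab.
  rewrite /Rintegral (integral_bigsetU_EFin mu mF).
  - rewrite sum_fine//= => i _; apply: integrable_fin_num => //.
    have [asi sis s'b] := sab i.
    apply: L_loc_integrableS nL _ _ => //; exact: subset_itv_oc_cc.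
  - exact: index_enum_uniq.
  - exact: sub_trivIset tF.
  - by have /integrableP[] := iA.
apply: ler_sum => i _; have [asi sis s'b] := sab i.
rewrite prim_diff//.
have ig := L_loc_integrable _ (s i) (s' i) gL.
apply: le_trans (le_normr_Rintegral _ ig) _ => //.
rewrite /F Rintegral_itv_obnd_cbnd//.
apply: L_loc_integrableS nL _ _ => //; exact: subset_itv_oc_cc.
Qed.
End PrimitiveRegularity.

(** * Absolutely continuous functions and Lebesgue differentiation *)

Section AbsoluteContinuity.
Context {R : realType}.
Local Notation mu := (@lebesgue_measure R).
Implicit Types (g u w : R -> R) (a b s t : R).

Lemma AC_uniform_continuous a b u : absolutely_continuous a b u ->
  forall e, 0 < e -> exists2 d, 0 < d &
    forall s t, a <= s -> t <= b -> s <= t -> t - s < d -> `|u t - u s| < e.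
Proof.
move=> uAC e e0; have [d d0 Hd] := uAC e e0; exists d => // s t as_ tb st std.
have := Hd 1 (fun=> s) (fun=> t); rewrite !big_ord1; apply => //.
by move=> i j; rewrite !ord1 eqxx.
Qed.

Lemma AC_loc_continuous u : AC_loc setT u -> continuous u.
Proof.
move=> uAC t; apply/cvgrPdist_lt => e e0.
have tt : t - 1 <= t + 1 by lra.
have [d d0 Hd] := AC_uniform_continuous _ _ _ (uAC _ _ tt (@subsetT _ _)) e e0.
near=> s.
have s1 : `|t - s| < 1 by near: s; apply: cvgr_dist_lt => //; exact: ltr01.
have sd : `|t - s| < d by near: s; apply: cvgr_dist_lt.
have [ts|st] := leP t s.
  rewrite distrC; apply: Hd => //; first by lra.
    by move: s1; rewrite ltr_distl; lra.
  by move: sd; rewrite ltr_distl; lra.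
apply: Hd; first by move: s1; rewrite ltr_distl; lra.
- lra.
- exact: ltW.
- by move: sd; rewrite ltr_distl; lra.
Unshelve. all: by end_near. Qed.

(** A nondecreasing time change phi that does not expand lengths maps a family
   of non-overlapping intervals to such a family of no larger total length.
   It is used with delays, with constant extensions and with truncations. *)
Lemma AC_loc_dominated (I : set R) u w (phi : R -> R) : AC_loc setT u ->
  (forall s t, s <= t -> phi s <= phi t /\ phi t - phi s <= t - s) ->
  (forall s t, s <= t -> `|w t - w s| <= `|u (phi t) - u (phi s)|) ->
  AC_loc I w.
Proof.
move=> uAC phi1 wu a b ab _ e e0.
have [pab _] := phi1 _ _ ab.
have [d d0 Hd] := uAC _ _ pab (@subsetT _ _) e e0.
exists d => // n s s' sab dis sd.
have := Hd n (phi \o s) (phi \o s'); rewrite /=.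
have H1 i :
  [/\ phi a <= phi (s i), phi (s i) <= phi (s' i) & phi (s' i) <= phi b].
  by have [/phi1[? _] /phi1[? _] /phi1[? _]] := sab i.
move=> /(_ H1) => H2; apply: le_lt_trans (H2 _ _).
- by apply: ler_sum => i _; have [_ ss _] := sab i; exact: wu.
- by move=> i j /dis [/phi1[]|/phi1[]]; [left|right].
- apply: le_lt_trans sd; apply: ler_sum => i _; have [_ ss _] := sab i.
  by have [] := phi1 _ _ ss.
Qed.

Lemma continuous_prim g : L_loc g -> continuous (prim g).
Proof. by move=> gL; apply: AC_loc_continuous; exact: AC_prim. Qed.

Lemma prim_uniform_continuous g a b : L_loc g ->
  forall e, 0 < e -> exists2 d, 0 < d &
  forall s t, a <= s -> t <= b -> s <= t -> t - s < d ->
    `|prim g t - prim g s| < e.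
Proof.
move=> gL e e0; have [ab|ba] := leP a b.
  exact: AC_uniform_continuous (AC_prim _ gL _ _ ab (@subsetT _ _)) _ e0.
exists 1 => // s t as_ tb st _.
by have := le_lt_trans (le_trans as_ (le_trans st tb)) ba; rewrite ltxx.
Qed.

(** Lebesgue differentiation concerns the integrals from one fixed endpoint; the
   endpoints 0, -1, -2, ... together reach every t. *)
Lemma prim_derive g : L_loc g ->
  {ae mu, forall t, derivable (prim g) t 1 /\ derive1 (prim g) t = g t}.
Proof.
move=> gL.
have H k : {ae mu, forall t, - k%:R < t ->
    derivable (prim g) t 1 /\ derive1 (prim g) t = g t}.
  have := @FTC1 R g (BLeft (- k%:R)) (fun y => L_loc_integrable g _ y gL) gL.
  apply: ae_imply => t H kt.
  have [] := H; first by rewrite lte_fin.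
  set F := (F in derivable F) => dF F'.
  have eqF : \forall s \near t, F s - F t + prim g t = prim g s.
    near=> s.
    have ks : - k%:R < s by near: s; exact: lt_nbhsr.
    rewrite /F -!prim_diff ?ltW//; ring.
  have dP : is_derive t 1 (prim g) (g t).
    apply: near_eq_is_derive eqF _.
    have FH : is_derive t 1 F (g t).
      by apply: DeriveDef => //; rewrite -derive1E.
    have := is_deriveD FH (is_derive_cst (- F t + prim g t) t 1).
    rewrite addr0; congr is_derive; apply/funext => s /=.
    by rewrite fctE /= addrA.
  by split; [exact: ex_derive|rewrite derive1E; exact: derive_val].
have := ae_foralln H; apply: ae_imply => t Ht.
have [n nt] : exists n : nat, - n%:R < t.
  exists (Num.bound `|- t|); rewrite ltrNl.
  by apply: le_lt_trans (ler_norm _) _; exact: archi_boundP (normr_ge0 _).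
exact: Ht n nt.
Unshelve. all: by end_near. Qed.
End AbsoluteContinuity.

(** * Continuous causal operators *)

Section Operators.
Context {R : realType}.
Local Notation mu := (@lebesgue_measure R).
Implicit Types (T : (R -> R) -> R -> R) (g u v : R -> R) (a b s t : R).

Lemma compact_cvg_seq (w : nat -> R -> R) u :
  (forall n t, `|t| <= n%:R -> `|w n t - u t| < n.+1%:R^-1) ->
  w @ \oo --> (u : {family compact, R -> R}).
Proof.
move=> wu; apply/fam_cvgP => A cA P /uniform_nbhs[E [entE EP]].
have [M [_ HM]] := compact_bounded cA.
move: entE; rewrite -entourage_from_ballE => -[e /= e0 eE].
change (\forall n \near \oo, P (w n)).
near=> n; apply: EP => y Ay; apply: eE; rewrite /= -ball_normE /= distrC.
apply: lt_le_trans (wu n y _) _.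
  apply: le_trans (HM (M + 1) _ y Ay) _; first by rewrite ltrDl.
  near: n; exact: nbhs_infty_ger.
by apply: ltW; near: n; exact: near_infty_natSinv_lt (PosNum e0).
Unshelve. all: by end_near. Qed.

(** Continuity C_loc -> L_loc in epsilon-delta form: a basic neighbourhood for
   locally uniform convergence is given by a window |t| <= k and a radius d. *)
Definition L1_continuous T : Prop :=
  (forall u, C_loc u -> L_loc (T u)) /\
  forall u a b (e : R), C_loc u -> 0 < e -> exists (k d : R), 0 < d /\
    forall v, C_loc v -> (forall t, `|t| <= k -> `|v t - u t| < d) ->
      \int[mu]_(t in `[a, b]) `|T v t - T u t| < e.

(** Otherwise some sequence converging locally uniformly to u has images that
   stay at distance at least e from T u in the mean on [a, b]. *)
Lemma continuous_operatorL1 T : continuous_operator T -> L1_continuous T.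
Proof.
move=> [TL Tc]; split=> // u a b e uc e0; apply: contrapT => H.
have W n : exists v,
  [/\ C_loc v, forall t, `|t| <= n%:R -> `|v t - u t| < n.+1%:R^-1
    & e <= \int[mu]_(t in `[a, b]) `|T v t - T u t| ].
  apply: contrapT => H'; apply: H; exists n%:R, n.+1%:R^-1; split => // v vc vu.
  by rewrite ltNge; apply/negP => ev; apply: H'; exists v.
have [w Hw] := choice W.
have wu : w @ \oo --> within C_loc (nbhs (u : {family compact, R -> R})).
  move=> P /(compact_cvg_seq w u (fun n => let: And3 _ h _ := Hw n in h)).
  rewrite /nbhs /= => wP; apply: filterS wP => n; apply.
  by have [] := Hw n.
have := cvg_comp _ _ wu (Tc u uc a b).
move=> /fine_cvgP[_] /cvgrPdist_lt/(_ _ e0)[n _ /(_ n (leqnn n))].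
rewrite /= sub0r normrN ltNge => /negP; apply.
have [_ _ ew] := Hw n; apply: le_trans ew _; exact: ler_norm.
Qed.

Lemma L1_continuousD T T' : L1_continuous T -> L1_continuous T' ->
  L1_continuous (fun u t => T u t + T' u t).
Proof.
move=> [TL Tc] [TL' Tc']; split.
  by move=> u uc; apply: L_locD; [exact: TL|exact: TL'].
move=> u a b e uc e0; have e2 : 0 < e / 2 by rewrite divr_gt0.
have [k [d [d0 H]]] := Tc u a b _ uc e2.
have [k' [d' [d'0 H']]] := Tc' u a b _ uc e2.
exists (Num.max k k'), (Num.min d d'); split; first by rewrite lt_min d0.
move=> v vc vu.
have {}H := H v vc; have {}H' := H' v vc.
rewrite (splitr e); apply: le_lt_trans (ltrD (H _) (H' _)); last 2 first.
- by move=> t tk; have := vu t; rewrite le_max tk lt_min => /(_ isT) /andP[].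
- move=> t tk; have := vu t.
  by rewrite le_max tk orbT lt_min => /(_ isT) /andP[].
have i1 := L_loc_norm _ (L_locB _ _ (TL v vc) (TL u uc)).
have i2 := L_loc_norm _ (L_locB _ _ (TL' v vc) (TL' u uc)).
rewrite -RintegralD//; [|exact: L_loc_integrable|exact: L_loc_integrable].
apply: le_Rintegral => //.
- apply: (L_loc_integrable (fun t => `|T v t + T' v t - (T u t + T' u t)|)).
  apply: L_loc_norm; apply: L_locB; apply: L_locD; by [exact: TL|exact: TL'].
- exact: (L_loc_integrable _ a b (L_locD _ _ i1 i2)).
- by move=> t _; apply: le_trans (ler_normD _ _); rewrite opprD addrACA.
Qed.

Lemma L1_continuousN T : L1_continuous T -> L1_continuous (fun u t => - T u t).
Proof.
move=> [TL Tc]; split; first by move=> u uc; apply: L_locN; exact: TL.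
move=> u a b e uc e0; have [k [d [d0 H]]] := Tc u a b _ uc e0.
exists k, d; split=> // v vc /(H v vc); apply: le_lt_trans.
rewrite le_eqVlt; apply/orP; left; apply/eqP; apply: eq_Rintegral => t _.
by rewrite -opprD normrN.
Qed.

(** This is the defining property of V, without the continuity of the operator,
   for all times at once. *)
Definition causal T : Prop := forall z u v, C_loc u -> C_loc v ->
  (forall t, t <= z -> u t = v t) -> {ae mu, forall t, t <= z -> T u t = T v t}.

Lemma V_causal T : V T -> causal T.
Proof. by move=> TV z; have [_] := TV z; apply. Qed.

Lemma causalD T T' : causal T -> causal T' ->
  causal (fun u t => T u t + T' u t).
Proof.
move=> cT cT' z u v uc vc uv.
apply: ae_imply2 (cT z u v uc vc uv) (cT' z u v uc vc uv) => t H H' tz.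
by rewrite H ?H'.
Qed.

Lemma causalN T : causal T -> causal (fun u t => - T u t).
Proof.
move=> cT z u v uc vc uv.
by apply: ae_imply (cT z u v uc vc uv) => t /[apply] ->.
Qed.

Lemma prim_causal T u v z s t : L1_continuous T -> causal T ->
  C_loc u -> C_loc v ->
  (forall r, r <= z -> u r = v r) -> s <= t -> t <= z ->
  prim (T u) t - prim (T u) s = prim (T v) t - prim (T v) s.
Proof.
move=> [TL _] cT uc vc uv st tz.
apply: prim_eq => //; [exact: TL|exact: TL|].
apply: ae_imply (cT z u v uc vc uv) => r H /andP[_ rt]; apply: H.
exact: le_trans tz.
Qed.

Lemma C_loc_extend_right z u : C_loc u -> C_loc (extend_right z u).
Proof.
move=> uc t; apply: continuous_comp; last exact: uc.
by apply: continuous_min => //; exact: cst_continuous.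
Qed.

Lemma extend_rightE z u t : t <= z -> extend_right z u t = u t.
Proof. by move=> tz; rewrite /extend_right min_l. Qed.

End Operators.

(** * Limits of approximate solutions *)

Section CompactnessOfApproximations.
Context {R : realType}.
Local Notation mu := (@lebesgue_measure R).

(** Convergence along an ultrafilter replaces the extraction of subsequences:
   every bounded real sequence has a limit. *)
Lemma ultra_bounded_cvg (U : set_system nat) (x : nat -> R) (M : R) :
  UltraFilter U -> (\forall n \near U, `|x n| <= M) ->
  exists l : R, x @ U --> l.
Proof.
move=> UU xM.
have cM := @segment_compact R (- M) M.
have [|l [_ clu]] := cM (x @ U) _.
  by apply: filterS xM => n; rewrite /= in_itv /= ler_norml.
exists l => A nA.
have [//|UnA] := in_ultra_setVsetC (x @^-1` A) UU.
have [y [/= nAy Ay]] := clu (~` A) A UnA nA.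
by [].
Qed.

Lemma exists_grid_cell (a d : R) (m : nat) (t : R) : 0 < d -> a <= t ->
  t < a + m%:R * d -> exists i : 'I_m, a + i%:R * d <= t < a + i.+1%:R * d.
Proof.
move=> d0; elim: m => [|m IH] at_.
  by rewrite mul0r addr0 ltNge at_.
have [tm _|mt tm1] := ltP t (a + m%:R * d).
  have [i Hi] := IH at_ tm.
  by exists (widen_ord (leqnSn m) i).
by exists ord_max; rewrite /= mt.
Qed.

Variables (H : (R -> R) -> R -> R) (t0 c : R).
Variables (u_ : nat -> R -> R) (dl : nat -> R).
Hypothesis HL : L1_continuous H.
Hypothesis uc : forall n, C_loc (u_ n).
Hypothesis ut0 : forall n, u_ n t0 = c.
Hypothesis dl01 : forall n, 0 <= dl n <= 1.
Hypothesis dl0 : dl @ \oo --> 0.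

(** What passes to the limit: an equation with vanishing delay, and a bound of
   the right-hand sides that is to be used with g independent of n. Both are
   localized to the window of radius k around t0, as the approximations below
   solve their equations on growing intervals only. *)
Definition approximate_on (k n : nat) (g : R -> R) : Prop :=
  {ae mu, forall t, t <= t0 + k%:R -> `|H (u_ n) t| <= g t} /\
  forall s t, t0 - k%:R <= s -> s <= t -> t <= t0 + k%:R ->
    u_ n t - u_ n s = prim (H (u_ n)) (t - dl n) - prim (H (u_ n)) (s - dl n).

Hypothesis approx : forall k : nat, exists g, L_loc g /\
  \forall n \near \oo, approximate_on k n g.

Let HuL n : L_loc (H (u_ n)). Proof. exact: HL.1. Qed.

Lemma approximation_increment k n g s t : L_loc g -> approximate_on k n g ->
  t0 - k%:R <= s -> s <= t -> t <= t0 + k%:R ->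
  `|u_ n t - u_ n s| <= prim g (t - dl n) - prim g (s - dl n).
Proof.
move=> gL [Hg eqn] ks st tk; rewrite eqn//.
have /andP[d0 d1] := dl01 n.
apply: prim_norm => //; first by rewrite lerD2r.
apply: ae_imply Hg => x Hx /andP[_ xt]; apply: Hx; lra.
Qed.

(** The increments are at most those of the fixed function prim g, up to a shift
   by dl n, and prim g is uniformly continuous on compact intervals. *)
Lemma approximation_equicontinuous k e : 0 < e -> exists2 d : R, 0 < d &
  \forall n \near \oo, forall s t, t0 - k%:R <= s -> s <= t -> t <= t0 + k%:R ->
    t - s < d -> `|u_ n t - u_ n s| <= e.
Proof.
move=> e0; have [g [gL ap]] := approx k.
have [d d0 Hd] := prim_uniform_continuous g (t0 - k%:R - 1) (t0 + k%:R) gL e e0.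
exists d => //; apply: filterS ap => n ap s t ks st tk std.
apply: le_trans (approximation_increment k n g s t gL ap ks st tk) _.
have /andP[dn0 dn1] := dl01 n.
apply/ltW/(le_lt_trans (ler_norm _)); apply: Hd; lra.
Qed.

Lemma approximation_bounded k : exists M : R, \forall n \near \oo,
  forall t, t0 - k%:R <= t -> t <= t0 + k%:R -> `|u_ n t| <= M.
Proof.
have [g [gL ap]] := approx k.
have k0 : 0 <= k%:R :> R by [].
pose N := \int[mu]_(x in `[t0 - k%:R - 1, t0 + k%:R]) `|g x|.
exists (`|c| + N); apply: filterS ap => n ap t kt tk.
have /andP[dn0 dn1] := dl01 n.
have PN a b : t0 - k%:R - 1 <= a -> a <= b -> b <= t0 + k%:R ->
    prim g b - prim g a <= N.
  move=> ka ab bk; have := prim_dist g (fun=> 0) _ _ _ _ gL L_loc0 ka ab bk.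
  rewrite !prim0 !subr0; under [X in _ <= X -> _]eq_Rintegral do rewrite subr0.
  by apply: le_trans; exact: ler_norm.
rewrite -[u_ n t](subrK (u_ n t0)) addrC; apply: le_trans (ler_normD _ _) _.
rewrite ut0 lerD2l -(ut0 n).
have [t0t|tt0] := leP t0 t.
  apply: le_trans (approximation_increment k n g t0 t gL ap _ _ _) _ => //.
    by lra.
  apply: PN; lra.
rewrite distrC.
apply: le_trans (approximation_increment k n g t t0 gL ap _ _ _) _ => //.
- by apply/ltW.
- by lra.
- by apply: PN; lra.
Qed.

Lemma exists_window t : exists k : nat, t0 - k%:R < t < t0 + k%:R.
Proof.
exists (Num.bound `|t - t0|).
have := archi_boundP (normr_ge0 (t - t0)); rewrite ltr_distl; lra.
Qed.

Lemma exists_window_itv s t : s <= t -> exists k : nat,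
  t0 - k%:R < s /\ t < t0 + k%:R.
Proof.
move=> st.
have [k Hk] := exists_window s; have [l Hl] := exists_window t.
exists (maxn k l).
have : k%:R <= (maxn k l)%:R :> R by rewrite ler_nat leq_maxl.
have : l%:R <= (maxn k l)%:R :> R by rewrite ler_nat leq_maxr.
lra.
Qed.

(** Pointwise limits along an ultrafilter exist by boundedness; by
   equicontinuity, controlled on a finite grid, the convergence is uniform on
   windows, so that H (u_ n) converges to H u in the mean on compact intervals
   and the integrated equation passes to the limit. The filter is kept in the
   conclusion because the signs, bounds and monotonicity of the u_ n are
   transferred to u afterwards. *)
Lemma limit_of_approximations : exists U : set_system nat,
  [/\ ProperFilter U, \oo `<=` U & exists u : R -> R,
  [/\ C_loc u, forall t, u_ ^~ t @ U --> u t &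
    forall s t, s <= t -> u t - u s = prim (H u) t - prim (H u) s]].
Proof.
have [U [UU ooU]] := ultraFilterLemma (eventually_filter : ProperFilter \oo).
exists U; split; [exact: ultra_proper|by []|].
have lim_ex t : exists l : R, u_ ^~ t @ U --> l.
  have [k /andP[kt tk]] := exists_window t.
  have [M HM] := approximation_bounded k.
  apply: (ultra_bounded_cvg U _ M UU); apply: filterS (ooU _ HM) => n; apply.
    exact: ltW.
  exact: ltW.
have [u Hu] := choice lim_ex.
have equi k e : 0 < e -> exists2 d : R, 0 < d & forall s t,
    t0 - k%:R <= s -> s <= t -> t <= t0 + k%:R -> t - s < d ->
    `|u t - u s| <= e.
  move=> e0; have [d d0 Hd] := approximation_equicontinuous k e e0.
  exists d => // s t ks st tk std.
  have cv : (fun n => `|u_ n t - u_ n s|) @ U --> `|u t - u s|.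
    by apply: cvg_norm; apply: cvgB; exact: Hu.
  apply: (cvgr_to_le cv).
  by apply: filterS (ooU _ Hd) => n; apply.
have ucont : C_loc u.
  move=> t; apply/cvgrPdist_lt => e e0.
  have [k /andP[kt tk]] := exists_window t.
  have e2 : 0 < e / 2 by rewrite divr_gt0.
  have [d d0 Hd] := equi k _ e2.
  have ee : e / 2 < e by rewrite ltr_pdivrMr// ltr_pMr// ltr1n.
  near=> s.
  have sd : `|t - s| < d by near: s; apply: cvgr_dist_lt.
  have ks : t0 - k%:R < s by near: s; exact: lt_nbhsr.
  have sk : s < t0 + k%:R by near: s; exact: lt_nbhsl.
  apply: le_lt_trans ee; have [ts|st] := leP t s.
    rewrite distrC; apply: Hd => //; try exact: ltW.
    by move: sd; rewrite ltr_distl; lra.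
  by apply: Hd; try exact: ltW; move: sd; rewrite ltr_distl; lra.
have unif k e : 0 < e -> \forall n \near U, forall t,
    t0 - k%:R <= t -> t <= t0 + k%:R -> `|u_ n t - u t| < e.
  move=> e0; have e3 : 0 < e / 4 by rewrite divr_gt0.
  have [d1 d10 Hd1] := approximation_equicontinuous k _ e3.
  have [d2 d20 Hd2] := equi k _ e3.
  (* The distance at t is compared with that at the grid point just before t. *)
  pose d := Num.min d1 d2.
  have d0 : 0 < d by rewrite lt_min d10.
  have [m Hm] : exists m : nat, t0 + k%:R < t0 - k%:R + m%:R * d.
    exists (Num.bound `|2 * k%:R / d|).
    have := archi_boundP (normr_ge0 (2 * k%:R / d)).
    move/(le_lt_trans (ler_norm _)); rewrite ltr_pdivrMr//; lra.
  have grid : \forall n \near U, forall i : 'I_m,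
      `|u_ n (t0 - k%:R + i%:R * d) - u (t0 - k%:R + i%:R * d)| < e / 4.
    apply: filter_forall => i.
    have /cvgrPdist_lt/(_ _ e3) := Hu (t0 - k%:R + i%:R * d).
    by apply: filterS => n; rewrite distrC.
  apply: filterS2 grid (ooU _ Hd1) => n Hg Hn t kt tk.
  have [i] := exists_grid_cell _ _ m t d0 kt (le_lt_trans tk Hm).
  rewrite -natr1 mulrDl mul1r addrA.
  set x := t0 - k%:R + i%:R * d => /andP[xt tx].
  have kx : t0 - k%:R <= x by rewrite /x lerDl mulr_ge0// ltW.
  have dd1 : d <= d1 by rewrite ge_min lexx.
  have dd2 : d <= d2 by rewrite ge_min lexx orbT.
  have h1 := Hn x t kx xt tk (_ : t - x < d1).
  have h2 := Hd2 x t kx xt tk (_ : t - x < d2).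
  have h3 := Hg i; rewrite -/x in h3.
  have {}h1 : `|u_ n t - u_ n x| <= e / 4 by apply: h1; lra.
  have {}h2 : `|u t - u x| <= e / 4 by apply: h2; lra.
  move: h1 h2 h3; rewrite !ler_distl !ltr_distl.
  by move=> /andP[? ?] /andP[? ?] /andP[? ?]; lra.
exists u; split => // s t st.
have [k [ks tk]] := exists_window_itv s t st.
have HuLu : L_loc (H u) by exact: HL.1.
have cvI : (fun n => (u_ n t - u_ n s) -
    (prim (H u) (t - dl n) - prim (H u) (s - dl n))) @ U --> 0.
  apply/cvgrPdist_lt => e e0.
  have [r [d [d0 Hd]]] := HL.2 u (s - 1) t e ucont e0.
  have rr : - `|r| <= `|r| by rewrite ge0_cp.
  have [l [lr rl]] := exists_window_itv _ _ rr.
  have [g [_ ap]] := approx k.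
  apply: filterS2 (unif l d d0) (ooU _ ap) => n un [_ apn].
  rewrite sub0r normrN apn//; try exact: ltW.
  have /andP[dn0 dn1] := dl01 n.
  apply: le_lt_trans (Hd _ (uc n) _).
    by apply: prim_dist => //; lra.
  move=> x xr; apply: un; move: xr; have := ler_norm r; rewrite ler_norml; lra.
have cvp x : (fun n => prim (H u) (x - dl n)) @ U --> prim (H u) x.
  have : (fun n => x - dl n) @ U --> x.
    rewrite -[X in _ --> X]subr0; apply: cvgB; first exact: cvg_cst.
    by move=> A /dl0; exact: ooU.
  by move=> h; apply: continuous_cvg h; exact: continuous_prim.
have cvL : (fun n => (u_ n t - u_ n s) -
    (prim (H u) (t - dl n) - prim (H u) (s - dl n))) @ U -->
    (u t - u s) - (prim (H u) t - prim (H u) s).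
  by apply: cvgB; apply: cvgB => //; exact: Hu.
by apply: subr0_eq; exact: (cvg_unique (@Rhausdorff R) cvL cvI).
Unshelve. all: by end_near. Qed.

End CompactnessOfApproximations.

(** * Retarded problems and shooting *)

Section DelayedShooting.
Context {R : realType}.
Local Notation mu := (@lebesgue_measure R).
Variables (H : (R -> R) -> R -> R) (t0 kappa c : R) (g : R -> R).
Hypothesis HL : L1_continuous H.
Hypothesis Hcausal : causal H.
Hypothesis gL : L_loc g.
Hypothesis Hg : forall v, C_loc v -> {ae mu, forall t, `|H v t| <= g t}.
Hypothesis H_ge0 : forall v, AC_loc setT v -> (forall t, t <= t0 -> 0 <= v t) ->
  (forall s t, s <= t -> t <= t0 -> v s <= v t) ->
  {ae mu, forall t, t <= t0 -> 0 <= H v t}.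
Hypothesis H_0 : forall v, C_loc v -> (forall t, t <= t0 -> v t = 0) ->
  {ae mu, forall t, t <= t0 -> H v t = 0}.
Hypothesis c_itv : 0 <= c <= kappa.

Let HuL u : C_loc u -> L_loc (H u). Proof. exact: HL.1. Qed.

Definition delay_step (a d y : R) (v : R -> R) (t : R) : R :=
  y + (prim (H v) (Num.max a (t - d)) - prim (H v) a).

Definition tonelli (a d y : R) (k : nat) : R -> R :=
  iter k (delay_step a d y) (cst y).

Let delay_subE (y p q r : R) : y + (p - r) - (y + (q - r)) = p - q.
Proof. ring. Qed.

Let delay_sub2E (y y' p q : R) : y + p - (y' + q) = (y - y') + (p - q).
Proof. ring. Qed.

Lemma delay_step_AC a d y v : C_loc v -> AC_loc setT (delay_step a d y v).
Proof.
move=> vc; apply: (AC_loc_dominated _ _ _ (fun t => Num.max a (t - d))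
  (AC_prim _ (HuL _ vc))).
  move=> s t st; split.
    by rewrite ge_max !le_max lexx/= lerD2r st orbT.
  by have [] := leP a (t - d); have [] := leP a (s - d); lra.
move=> s t st; rewrite /delay_step.
by rewrite delay_subE.
Qed.

Lemma AC_loc_cst (I : set R) (y : R) : AC_loc I (cst y).
Proof.
move=> a b _ _ e e0; exists 1 => // n s s' _ _ _.
by rewrite big1// => i _; rewrite subrr normr0.
Qed.

Lemma tonelli_AC a d y k : AC_loc setT (tonelli a d y k).
Proof.
elim: k => [|k IH]; first exact: AC_loc_cst.
by apply: delay_step_AC; exact: AC_loc_continuous.
Qed.

Lemma tonelli_continuous a d y k : C_loc (tonelli a d y k).
Proof. exact: AC_loc_continuous (tonelli_AC a d y k). Qed.

Lemma tonelliS a d y k t :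
  tonelli a d y k.+1 t = delay_step a d y (tonelli a d y k) t.
Proof. by []. Qed.

(** By causality the k-th iterate is already a solution of the retarded problem
   up to time a + k d, hence a finite number of iterations reaches any time. *)
Lemma tonelli_stable a d y k t : 0 <= d -> t <= a + k%:R * d ->
  tonelli a d y k.+1 t = tonelli a d y k t.
Proof.
move=> d0; elim: k t => [|k IH] t.
  rewrite mul0r addr0 => ta; rewrite tonelliS /delay_step max_l; last by lra.
  by rewrite subrr addr0.
rewrite -natr1 mulrDl mul1r => tk.
rewrite [LHS]tonelliS [RHS]tonelliS /delay_step; congr (y + _).
have kd : 0 <= k%:R * d by rewrite mulr_ge0.
apply: (prim_causal _ _ _ (a + k%:R * d)) => //.
- exact: tonelli_continuous.
- exact: tonelli_continuous.
- by rewrite le_max lexx.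
- by rewrite ge_max; apply/andP; split; lra.
Qed.

(** A nondecreasing nonnegative iterate has a nonnegative right-hand side on the
   past of t0, so the next iterate is nondecreasing there too. *)
Lemma tonelli_nondecreasing a d y k : 0 <= d -> 0 <= y -> a <= t0 ->
  (forall t, t <= t0 -> y <= tonelli a d y k t) /\
  (forall s t, s <= t -> t <= t0 -> tonelli a d y k s <= tonelli a d y k t).
Proof.
move=> d0 y0 at0; elim: k => [|k [yv IH]]; first by split.
have vAC := tonelli_AC a d y k.
have vc := tonelli_continuous a d y k.
have v0 t : t <= t0 -> 0 <= tonelli a d y k t by move=> /yv; exact: le_trans.
have Hv := H_ge0 _ vAC v0 IH.
have mono s t : s <= t -> t <= t0 ->
    prim (H (tonelli a d y k)) s <= prim (H (tonelli a d y k)) t.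
  move=> st tt0; apply: prim_ge0 => //; first exact: HuL.
  by apply: ae_imply Hv => x Hx /andP[_ xt]; apply: Hx; exact: le_trans tt0.
split=> [t tt0|s t st tt0]; rewrite tonelliS /delay_step.
  rewrite lerDl subr_ge0; apply: mono; first by rewrite le_max lexx.
  by rewrite ge_max at0; lra.
rewrite lerD2l lerD2r; apply: mono.
  by rewrite ge_max !le_max lexx/= lerD2r st orbT.
by rewrite ge_max at0; lra.
Qed.

Lemma tonelli0 a d k t : 0 <= d -> a <= t0 -> t <= t0 -> tonelli a d 0 k t = 0.
Proof.
move=> d0 at0; elim: k t => [//|k IH] t tt0.
rewrite tonelliS /delay_step add0r.
have vc := tonelli_continuous a d 0 k.
rewrite (prim_eq _ (fun=> 0)).
- by rewrite !prim0 subrr.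
- exact: HuL.
- exact: L_loc0.
- by rewrite le_max lexx.
- apply: ae_imply (H_0 _ vc IH) => x Hx /andP[_ xt]; apply: Hx.
  by apply: le_trans xt _; rewrite ge_max at0; lra.
Qed.

(** The step maps locally uniform convergence to itself because H is continuous
   into L_loc; only finitely many steps are made. *)
Lemma tonelli_initial_continuous a d k : 0 <= d -> forall y K e, 0 < e ->
  exists2 r : R, 0 < r & forall y', `|y' - y| < r ->
    forall t, `|t| <= K -> `|tonelli a d y' k t - tonelli a d y k t| < e.
Proof.
move=> d0; elim: k => [|k IH] y K e e0; first by exists e.
have e2 : 0 < e / 2 by rewrite divr_gt0.
have [m [r [r0 Hr]]] :=
  HL.2 _ a (Num.max a K) _ (tonelli_continuous a d y k) e2.
have [r' r'0 Hr'] := IH y m r r0.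
exists (Num.min r' (e / 2)); first by rewrite lt_min r'0.
move=> y'; rewrite lt_min => /andP[yr' ye] t tK.
have {}Hr := Hr _ (tonelli_continuous a d y' k) (Hr' _ yr').
rewrite !tonelliS /delay_step delay_sub2E (splitr e).
apply: le_lt_trans (ler_normD _ _) _; apply: ltrD => //.
apply: le_lt_trans Hr; apply: prim_dist => //.
- by apply: HuL; exact: tonelli_continuous.
- by apply: HuL; exact: tonelli_continuous.
- by rewrite le_max lexx.
- rewrite ge_max !le_max lexx/=; apply/orP; right.
  by move: tK; rewrite ler_norml; lra.
Qed.

(** The value at t0 is 0 for y = 0 and at least kappa for y = kappa. *)
Lemma tonelli_shooting a d k : 0 <= d -> a <= t0 ->
  exists2 y, 0 <= y & tonelli a d y k t0 = c.
Proof.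
move=> d0 at0; have /andP[c0 ck] := c_itv.
have k0 : 0 <= kappa by exact: le_trans ck.
pose F y := tonelli a d y k t0.
have Fc : continuous F.
  move=> y; apply/cvgrPdist_lt => e e0.
  have [r r0 Hr] := tonelli_initial_continuous a d k d0 y `|t0| e e0.
  near=> y'; rewrite distrC; apply: Hr => //.
have F0 : F 0 = 0 by exact: tonelli0.
have Fk : kappa <= F kappa.
  by have [+ _] := tonelli_nondecreasing a d kappa k d0 k0 at0; apply.
have [|y] := @IVT R F 0 kappa c k0 (continuous_subspaceT Fc).
  by rewrite F0 ge_min le_max c0 (le_trans ck Fk) orbT.
by rewrite in_itv /= => /andP[y0 _] Fy; exists y.
Unshelve. all: by end_near. Qed.

(** Start the shooting at time t0 - n with delay 1 / (n + 1) and let n tend to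
   infinity. *)
Lemma exists_solution_monotone_past : exists u : R -> R,
  [/\ C_loc u, u t0 = c, forall t, t <= t0 -> 0 <= u t <= kappa,
    forall s t, s <= t -> t <= t0 -> u s <= u t &
    forall s t, s <= t -> u t - u s = prim (H u) t - prim (H u) s].
Proof.
pose dl (n : nat) : R := n.+1%:R^-1.
have dl0 n : 0 <= dl n by rewrite invr_ge0.
have dl1 n : dl n <= 1 by rewrite invf_le1// ler1n.
pose a (n : nat) : R := t0 - n%:R.
have at0 n : a n <= t0 by rewrite gerBl.
(* Number of steps of length dl n needed to go from a n to t0 + n. *)
pose k (n : nat) := (2 * n * n.+1)%N.
have akd n : a n + (k n)%:R * dl n = t0 + n%:R.
  by rewrite /a /k /dl natrM mulfK ?pnatr_eq0// natrM; lra.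
have shoot n : exists y, 0 <= y /\ tonelli (a n) (dl n) y (k n) t0 = c.
  by have [y y0 yc] := tonelli_shooting _ _ (k n) (dl0 n) (at0 n); exists y.
have [y Hy] := choice shoot.
pose u_ n := tonelli (a n) (dl n) (y n) (k n).
have uc n : C_loc (u_ n) by exact: tonelli_continuous.
have ut0 n : u_ n t0 = c by have [] := Hy n.
have mono n : (forall t, t <= t0 -> y n <= u_ n t) /\
  (forall s t, s <= t -> t <= t0 -> u_ n s <= u_ n t).
  by apply: tonelli_nondecreasing => //; have [] := Hy n.
have step n t : t <= t0 + n%:R ->
    u_ n t = delay_step (a n) (dl n) (y n) (u_ n) t.
  rewrite -akd => /(tonelli_stable _ _ (y n) _ _ (dl0 n)) E.
  by rewrite {1}/u_ -E.
have dlc : dl @ \oo --> 0 by exact: cvg_harmonic.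
have dl01 n : 0 <= dl n <= 1 by rewrite dl0 dl1.
(* For n > m the delayed window of radius m does not reach a n. *)
have approx m : exists g, L_loc g /\
    \forall n \near \oo, approximate_on H t0 u_ dl m n g.
  exists g; split => //; near=> n.
  have mn : (m < n)%N by near: n; exact: nbhs_infty_gt.
  have mnR : m%:R + 1 <= n%:R :> R by rewrite natr1 ler_nat.
  split; first by apply: ae_imply (Hg _ (uc n)).
  move=> s t ms st tm; have := dl1 n => d1.
  rewrite !step; [|lra|lra]; rewrite /delay_step !max_r /a; [|lra|lra].
  exact: delay_subE.
have [U [UF ooU [u [ucont Uu ueq]]]] :=
  limit_of_approximations H t0 c u_ dl HL uc ut0 dl01 dlc approx.
have /andP[c0 ck] := c_itv.
have umono s t : s <= t -> t <= t0 -> u s <= u t.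
  move=> st tt0; apply: (ler_cvg_to (Uu s) (Uu t)); apply: nearW => n.
  by have [_] := mono n; apply.
have ut0c : u t0 = c.
  apply: (cvg_unique (@Rhausdorff R) (Uu t0)).
  by rewrite (_ : u_^~ t0 = cst c); [exact: cvg_cst|apply/funext => n].
exists u; split => //.
move=> t tt0; apply/andP; split; last first.
  by apply: le_trans (umono t t0 tt0 (lexx _)) _; rewrite ut0c.
apply: (cvgr_to_ge (Uu t)); apply: nearW => n.
have [y0 _] := Hy n; have [yu _] := mono n.
exact: le_trans (yu t tt0).
Unshelve. all: by end_near. Qed.

End DelayedShooting.

(** * A priori bound *)

Section AprioriBound.
Context {R : realType}.

Lemma first_hitting_time (w : R -> R) (a b x : R) : continuous w -> a <= b ->
  w a < x -> x <= w b -> exists tau, [/\ a < tau, tau <= b, w tau = x &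
    forall r, a <= r -> r < tau -> w r < x].
Proof.
move=> wc ab wax xwb.
pose S := [set t | a <= t <= b /\ x <= w t].
have Sb : S b by split; [rewrite ab lexx|].
have Slb : has_lbound S by exists a => t [/andP[]].
have Sinf : has_inf S by split; [exists b|].
pose tau := inf S.
have at_ : a <= tau by apply: lb_le_inf; [exists b|move=> t [/andP[]]].
have tb : tau <= b by exact: ge_inf.
have below r : a <= r -> r < tau -> w r < x.
  move=> ar rt; rewrite ltNge; apply/negP => xr.
  have : tau <= r.
    by apply: ge_inf => //; split; rewrite // ar (ltW (lt_le_trans rt tb)).
  by rewrite leNgt rt.
have xw : x <= w tau.
  rewrite leNgt; apply/negP => wx.
  have [e /= e0 He] : \forall s \near tau, w s < x.
    exact: (cvgr_lt _ (wc tau)).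
  have [s [sab xs] st] := inf_adherent e0 Sinf.
  have ts : tau <= s by exact: ge_inf.
  have : w s < x.
    by apply: He; rewrite /= distrC ger0_norm ?subr_ge0// ltrBlDl.
  by rewrite ltNge xs.
have at' : a < tau.
  rewrite lt_neqAle at_ andbT; apply/eqP => E.
  by move: wax; rewrite E ltNge xw.
exists tau; split => //; apply/eqP; rewrite eq_le xw andbT leNgt.
apply/negP => xt.
have [e /= e0 He] : \forall s \near tau, x < w s.
  exact: (cvgr_gt _ (wc tau)).
pose s := Num.max a (tau - e / 2).
have st : s < tau by rewrite gt_max at'/=; lra.
have as_ : a <= s by rewrite le_max lexx.
have : x < w s.
  apply: He; rewrite /= ger0_norm ?subr_ge0 ?ltW//.
  have : tau - e / 2 <= s by rewrite le_max lexx orbT.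
  lra.
by rewrite ltNge ltW// below.
Qed.

(** Apply first_hitting_time after reversing time and changing the sign. *)
Lemma last_exit_time (w : R -> R) (a b x : R) : continuous w -> a <= b ->
  w a <= x -> x < w b -> exists s, [/\ a <= s, s < b, w s = x &
    forall r, s < r -> r <= b -> x < w r].
Proof.
move=> wc ab wax xwb.
have w'c : continuous (fun t => - w (- t)).
  move=> t; apply: continuousN; apply: continuous_comp; last exact: wc.
  exact: opp_continuous.
have [||| t [bt ta wt Ht]] := first_hitting_time _ (- b) (- a) (- x) w'c.
- by rewrite lerN2.
- by rewrite opprK ltrN2.
- by rewrite opprK lerN2.
exists (- t); split; [lra|lra|exact: oppr_inj|].
move=> r tr rb; have := Ht (- r); rewrite opprK ltrN2; apply; lra.
Qed.

Variables (h : (R -> R) -> R -> R) (t0 kappa : R).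
Variables (p : R -> R) (Q : R -> R -> R).
Hypothesis hL : L1_continuous h.
Hypothesis hcausal : causal h.
Hypothesis kappa_gt0 : 0 < kappa.
Hypothesis pL : L_loc p.
Hypothesis Q_lim : forall b, t0 < b -> x^-1 * Q b x @[x --> +oo] --> (0 : R).

Definition initially_small (v : R -> R) : Prop :=
  0 <= v t0 /\ forall r, r <= t0 -> `|v r| <= kappa.

Hypothesis h_growth : forall e v x s t b, `|e| = 1 -> C_loc v ->
  (forall r, `|v r| <= x) -> initially_small v ->
  t0 <= s -> s <= t -> t <= b -> t0 < b ->
  (forall r, s <= r -> r <= t -> 0 < e * v r) ->
  e * (prim (h v) t - prim (h v) s) <= x * (prim p t - prim p s) + Q b x.

(** The equation is only required up to times before which u does not exceed B;
   this is what a solution of an equation truncated at level B satisfies. *)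
Definition solves_while (B : R) (u : R -> R) : Prop :=
  forall tau, t0 <= tau -> (forall r, r <= tau -> `|u r| <= B) ->
  forall s t, s <= t -> t <= tau -> u t - u s = prim (h u) t - prim (h u) s.

Lemma solves_whileS B B' u : B <= B' -> solves_while B' u -> solves_while B u.
Proof.
move=> BB' sB' tau t0tau uB; apply: sB' => // r /uB uBr.
exact: le_trans BB'.
Qed.

(** If |u| exceeded x before s1, let tau be the first time at which |u| equals x
   and s the last time before tau at which it equals r. In between u keeps a
   constant sign e, so the growth condition applies and gives
   x - r <= x / 4 + x / 4, contradicting 2 r < x. No chain rule for |u| is
   involved. *)
Lemma bound_propagates (b s0 s1 r x : R) u :
  t0 <= s0 -> s0 <= s1 -> s1 <= b -> t0 < b -> kappa <= r -> 2 * r < x ->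
  x^-1 * Q b x <= 4^-1 ->
  (forall s t, s0 <= s -> s <= t -> t <= s1 -> prim p t - prim p s <= 4^-1) ->
  C_loc u -> initially_small u -> (forall t, t <= s0 -> `|u t| <= r) ->
  solves_while x u -> forall t, t <= s1 -> `|u t| <= x.
Proof.
move=> t0s0 s01 s1b t0b kr rx Qx px uc uinit ur usol t ts1.
have k0 := kappa_gt0.
have r0 : 0 < r by lra.
have x0 : 0 < x by lra.
have rlex : r <= x by lra.
have [ts0|s0t] := leP t s0; first by apply: le_trans (ur t ts0) _.
rewrite leNgt; apply/negP => xut.
have nc : continuous (fun t => `|u t|).
  by move=> z; apply: continuous_comp; [exact: uc|exact: norm_continuous].
have us0x : `|u s0| < x by apply: le_lt_trans (ur _ (lexx _)) _; lra.
have [tau [s0tau taut utau below]] :=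
  first_hitting_time _ s0 t x nc (ltW s0t) us0x (ltW xut).
have bound z : z <= tau -> `|u z| <= x.
  move=> ztau; have [zs0|s0z] := leP z s0; first exact: le_trans (ur z zs0) _.
  move: ztau; rewrite le_eqVlt => /predU1P[->|ztau]; first by rewrite utau.
  by apply/ltW/below => //; exact: ltW.
(* Multiplying by the sign of u tau treats hitting x and hitting -x alike. *)
pose e := Num.sg (u tau).
have utau0 : u tau != 0 by rewrite -normr_gt0 utau.
have e1 : `|e| = 1 by rewrite normr_sg utau0.
have eu : e * u tau = x by rewrite -utau normrEsg.
have wc : continuous (fun t => e * u t).
  move=> z; apply: (@continuousM R R (cst e) u); last exact: uc.
  exact: cst_continuous.
have [|||s [s0s stau us above]] :=
  last_exit_time (fun t => e * u t) s0 tau r wc.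
- exact: ltW.
- apply: le_trans (ler_norm _) _; rewrite normrM e1 mul1r; exact: ur.
- by rewrite eu; lra.
(* The growth condition needs a bound on the whole line: freeze u after tau. *)
pose v := extend_right tau u.
have vc : C_loc v by exact: C_loc_extend_right.
have t0tau : t0 <= tau by lra.
have vx z : `|v z| <= x by apply: bound; rewrite ge_min lexx orbT.
have vinit : initially_small v.
  split; first by rewrite /v extend_rightE//; have [] := uinit.
  move=> z zt0; rewrite /v extend_rightE; last exact: le_trans t0tau.
  by have [_] := uinit; apply.
have t0s : t0 <= s by lra.
have taub : tau <= b by lra.
have pos z : s <= z -> z <= tau -> 0 < e * v z.
  move=> + ztau; rewrite /v extend_rightE// le_eqVlt => /predU1P[<-|sz].
    by rewrite us.
  exact: lt_trans (above z sz ztau).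
have G := h_growth e v x s tau b e1 vc vx vinit t0s (ltW stau) taub t0b pos.
have uv z : z <= tau -> u z = v z by move=> ztau; rewrite /v extend_rightE.
rewrite -(prim_causal h u v tau s tau hL hcausal uc vc uv (ltW stau)) // in G.
rewrite -(usol tau t0tau bound s tau (ltW stau) (lexx _)) mulrBr eu us in G.
have P := px s tau s0s (ltW stau) (le_trans taut ts1).
have : x * (prim p tau - prim p s) <= x * 4^-1 by rewrite ler_pM2l.
have : Q b x <= x * 4^-1 by rewrite -ler_pdivrMl.
lra.
Qed.

(** Cover [t0, b] by finitely many intervals on which prim p increases by at
   most 1/4 and apply bound_propagates on each of them, enlarging the bound
   every time. *)
Lemma apriori_bound b : t0 < b -> exists B : R, kappa <= B /\
  forall u, C_loc u -> initially_small u -> solves_while B u ->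
  forall t, t <= b -> `|u t| <= B.
Proof.
move=> t0b; have k0 := kappa_gt0.
have q4 : 0 < 4^-1 :> R by rewrite invr_gt0.
have [x0 [_ Hx0]] : \forall x \near +oo, x^-1 * Q b x <= 4^-1.
  exact: (cvgr_le _ (Q_lim b t0b)).
(* Half of the modulus of continuity, since increments are bounded for lengths
   strictly less than d. *)
have [d d0 Hd] := prim_uniform_continuous p t0 b pL _ q4.
have d2 : 0 < d / 2 by rewrite divr_gt0.
suff H (m : nat) : exists B : R, kappa <= B /\
  forall u, C_loc u -> initially_small u -> solves_while B u ->
  forall t, t <= Num.min b (t0 + m%:R * (d / 2)) -> `|u t| <= B.
  pose m := Num.bound `|(b - t0) / (d / 2)|.
  have bm : b <= t0 + m%:R * (d / 2).
    have := archi_boundP (normr_ge0 ((b - t0) / (d / 2))).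
    move/(le_lt_trans (ler_norm _)); rewrite ltr_pdivrMr// -/m; lra.
  have [B [kB HB]] := H m; exists B; split => // u uc ui us t tb.
  by apply: HB => //; rewrite le_min tb (le_trans tb).
elim: m => [|m [B [kB HB]]].
  exists kappa; split => // u uc [_ ui] us t.
  by rewrite mul0r addr0 le_min => /andP[_]; exact: ui.
(* Large enough for Q b B' <= B' / 4 and for 2 B < B'. *)
pose B' := Num.max (x0 + 1) (2 * B + 1).
have B'x0 : x0 < B' by rewrite lt_max ltrDl ltr01.
have B'B : 2 * B < B' by rewrite lt_max ltrDl ltr01 orbT.
have BB' : B <= B' by lra.
exists B'; split; first by lra.
move=> u uc ui us.
have md : 0 <= m%:R * (d / 2) by rewrite mulr_ge0// ltW.
have mS : t0 + m.+1%:R * (d / 2) = t0 + m%:R * (d / 2) + d / 2.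
  by rewrite -natr1 mulrDl mul1r addrA.
apply: (bound_propagates b (Num.min b (t0 + m%:R * (d / 2)))
   (Num.min b (t0 + m.+1%:R * (d / 2))) B B' u) => //.
- by rewrite le_min (ltW t0b)/=; lra.
- by rewrite le_min !ge_min lexx/=; apply/orP; right; rewrite mS; lra.
- by rewrite ge_min lexx.
- exact: Hx0.
- move=> s t ms st tm; apply/ltW/(le_lt_trans (ler_norm _)).
  move: tm; rewrite le_min mS => /andP[tb tm].
  have t0s : t0 <= s by apply: le_trans ms; rewrite le_min (ltW t0b)/=; lra.
  apply: Hd => //.
  move: ms; rewrite ge_min => /orP[bs|ms]; lra.
- by apply: HB => //; exact: solves_whileS us.
Qed.

End AprioriBound.

(** * Global existence by truncation *)

Section GlobalExistence.
Context {R : realType}.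
Local Notation mu := (@lebesgue_measure R).

Definition clamp (lo hi x : R) : R := Num.max lo (Num.min hi x).

Lemma clamp_itv lo hi x : lo <= hi -> lo <= clamp lo hi x <= hi.
Proof. by move=> lh; rewrite /clamp le_max lexx/= ge_max lh ge_min lexx. Qed.

Lemma clamp_id lo hi x : lo <= x <= hi -> clamp lo hi x = x.
Proof. by move=> /andP[lx xh]; rewrite /clamp min_r// max_r. Qed.

Lemma clamp_dist lo hi x y : `|clamp lo hi x - clamp lo hi y| <= `|x - y|.
Proof.
suff H a b : a <= b ->
    clamp lo hi a <= clamp lo hi b <= clamp lo hi a + (b - a).
  have [xy|/ltW yx] := leP x y; [rewrite distrC [leRHS]distrC|].
    by have /andP[h0 h1] := H _ _ xy; rewrite !ger0_norm ?subr_ge0// lerBlDl.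
  by have /andP[h0 h1] := H _ _ yx; rewrite !ger0_norm ?subr_ge0// lerBlDl.
move=> ab; have ba : 0 <= b - a by rewrite subr_ge0.
apply/andP; split.
  by rewrite /clamp ge_max !le_max lexx/= le_min !ge_min lexx ab !orbT.
rewrite {1}/clamp ge_max; apply/andP; split.
  by rewrite -[leLHS]addr0 lerD// /clamp le_max lexx.
apply: (@le_trans _ _ (Num.min hi a + (b - a))); last first.
  by rewrite lerD2r /clamp le_max lexx orbT.
have [ha|ah] := leP hi a; first by rewrite ge_min lerDl ba.
by rewrite addrC subrK ge_min lexx orbT.
Qed.

Variables (h : (R -> R) -> R -> R) (t0 kappa c : R).
Variables (p : R -> R) (Q : R -> R -> R).
Hypothesis hL : L1_continuous h.
Hypothesis hcausal : causal h.
Hypothesis h_dominated : forall r : R, 0 < r -> exists2 g, L_loc g &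
  forall v, C_loc v -> (forall t, `|v t| <= r) ->
    {ae mu, forall t, `|h v t| <= g t}.
Hypothesis h_ge0 : forall v, AC_loc setT v -> (forall t, 0 <= v t <= kappa) ->
  (forall s t, s <= t -> t <= t0 -> v s <= v t) ->
  {ae mu, forall t, t <= t0 -> 0 <= h v t}.
Hypothesis h_0 : {ae mu, forall t, t <= t0 -> h (fun=> 0) t = 0}.
Hypothesis kappa_gt0 : 0 < kappa.
Hypothesis c_itv : 0 <= c <= kappa.
Hypothesis pL : L_loc p.
Hypothesis Q_lim : forall b, t0 < b -> x^-1 * Q b x @[x --> +oo] --> (0 : R).
Hypothesis h_growth : forall e v x s t b, `|e| = 1 -> C_loc v ->
  (forall r, `|v r| <= x) -> initially_small t0 kappa v ->
  t0 <= s -> s <= t -> t <= b -> t0 < b ->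
  (forall r, s <= r -> r <= t -> 0 < e * v r) ->
  e * (prim (h v) t - prim (h v) s) <= x * (prim p t - prim p s) + Q b x.

(** Clamping v to [0, kappa] before t0 and to [-B, B] afterwards would break
   continuity at t0, so that after t0 it is the increment v t - v t0 that is
   clamped. *)
Definition truncate (B : R) (v : R -> R) (t : R) : R :=
  clamp 0 kappa (v (Num.min t t0)) +
  clamp (- (2 * B)) (2 * B) (v t - v (Num.min t t0)).

Let min_past t : t <= t0 -> Num.min t t0 = t. Proof. exact: min_l. Qed.

Lemma truncation_dist B x x' y y' d : `|x - y| < d -> `|x' - y'| < d ->
  `|(clamp 0 kappa x' + clamp (- (2 * B)) (2 * B) (x - x')) -
    (clamp 0 kappa y' + clamp (- (2 * B)) (2 * B) (y - y'))| < 3 * d.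
Proof.
move=> xy xy'.
rewrite opprD addrACA; apply: le_lt_trans (ler_normD _ _) _.
have := clamp_dist 0 kappa x' y'.
have := clamp_dist (- (2 * B)) (2 * B) (x - x') (y - y').
have : `|x - x' - (y - y')| <= `|x - y| + `|x' - y'|.
  rewrite (_ : x - x' - (y - y') = (x - y) - (x' - y')); last by ring.
  exact: ler_normB.
lra.
Qed.

Lemma C_loc_truncate B v : C_loc v -> C_loc (truncate B v).
Proof.
move=> vc t; apply/cvgrPdist_lt => e e0.
have e3 : 0 < e / 3 by rewrite divr_gt0.
have mc : C_loc (extend_right t0 v) by exact: C_loc_extend_right.
have /cvgrPdist_lt/(_ _ e3) H1 := vc t.
have /cvgrPdist_lt/(_ _ e3) H2 := mc t.
apply: filterS2 H1 H2 => s H1 H2.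
by have := truncation_dist B _ _ _ _ _ H1 H2; rewrite [3 * _]mulrC divfK.
Qed.

Lemma truncate_norm B v t : 0 <= B -> `|truncate B v t| <= kappa + 2 * B.
Proof.
move=> B0; have k0 := kappa_gt0.
have B2 : - (2 * B) <= 2 * B by lra.
have := clamp_itv 0 kappa (v (Num.min t t0)) (ltW k0).
have := clamp_itv _ _ (v t - v (Num.min t t0)) B2.
rewrite ler_norml /truncate; lra.
Qed.

Lemma truncate_past B v t : 0 <= B -> t <= t0 ->
  truncate B v t = clamp 0 kappa (v t).
Proof.
move=> B0 tt0; rewrite /truncate min_past// subrr.
by rewrite [X in _ + X]clamp_id ?addr0//; lra.
Qed.

(** Both v t and v t0 are bounded by B in absolute value, so the level 2 B for
   their difference is never reached. *)
Lemma truncate_id B v t : (forall s, s <= t0 -> 0 <= v s <= kappa) ->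
  (forall s, s <= t -> `|v s| <= B) -> truncate B v t = v t.
Proof.
move=> v0 vB; have mt : Num.min t t0 <= t by rewrite ge_min lexx.
rewrite /truncate [X in X + _]clamp_id; last first.
  by apply: v0; rewrite ge_min lexx orbT.
rewrite clamp_id; first by rewrite addrC subrK.
have := vB t (lexx _); have := vB _ mt; rewrite !ler_norml; lra.
Qed.

(** The truncation takes values in a bounded set, so that the Caratheodory
   condition dominates the right-hand side for all arguments at once. *)
Lemma truncated_solution B : kappa <= B -> exists u : R -> R,
  [/\ C_loc u, u t0 = c, forall t, t <= t0 -> 0 <= u t <= kappa,
    forall s t, s <= t -> t <= t0 -> u s <= u t & solves_while h t0 B u].
Proof.
move=> kB; have k0 := kappa_gt0; have B0 : 0 <= B by lra.
have kB2 : 0 < kappa + 2 * B by lra.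
have [g gL Hg] := h_dominated _ kB2.
have [||||||u [uc uc0 u0k umono ueq]] :=
    @exists_solution_monotone_past R (h \o truncate B) t0 kappa c g _ _ gL.
- split; first by move=> v vc; apply: hL.1; exact: C_loc_truncate.
  move=> v a b e vc e0.
  have [k [d [d0 Hd]]] := hL.2 _ a b e (C_loc_truncate B v vc) e0.
  exists (`|k| + `|t0|), (d / 3); split; first by rewrite divr_gt0.
  move=> w wc wv; apply: Hd; first exact: C_loc_truncate.
  move=> t tk; rewrite (_ : d = 3 * (d / 3)); last by rewrite mulrC divfK.
  have tk' : `|t| <= `|k| + `|t0|.
    by apply: le_trans tk _; apply: le_trans (ler_norm _) _; rewrite lerDl.
  apply: truncation_dist; apply: wv => //.
  by rewrite /Num.min; case: ifP => // _; rewrite lerDr.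
- move=> z v w vc wc vw; apply: hcausal; try exact: C_loc_truncate.
  move=> t tz; rewrite /truncate !vw// ge_min tz//.
- move=> v vc; apply: Hg; first exact: C_loc_truncate.
  by move=> t; exact: truncate_norm.
- move=> v vAC v0 vmono.
  have vc := AC_loc_continuous _ vAC.
  (* On the past of t0 the truncation of v agrees with w, which is absolutely
     continuous on the whole line. *)
  pose w t := Num.min kappa (v (Num.min t t0)).
  have wAC : AC_loc setT w.
    apply: (AC_loc_dominated _ v _ (fun t => Num.min t t0)) => //.
      move=> s t st; split; first by rewrite le_min !ge_min lexx st orbT.
      by have [] := leP t t0; have [] := leP s t0; lra.
    move=> s t st; rewrite /w.
    have lo x : 0 <= x -> Num.min kappa x = clamp 0 kappa x.
      by move=> x0; rewrite /clamp max_r// le_min x0 ltW.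
    rewrite !lo; [exact: clamp_dist| |]; apply: v0; by rewrite ge_min lexx orbT.
  have wc := AC_loc_continuous _ wAC.
  have w0k t : 0 <= w t <= kappa.
    by rewrite /w le_min (ltW k0)/= ge_min lexx/= v0// ge_min lexx orbT.
  have wmono s t : s <= t -> t <= t0 -> w s <= w t.
    move=> st tt0; rewrite /w !min_past//; last exact: le_trans tt0.
    by rewrite le_min !ge_min lexx/= vmono ?orbT.
  have wv t : t <= t0 -> w t = truncate B v t.
    move=> tt0; rewrite truncate_past// /w min_past// /clamp max_r//.
    by rewrite le_min v0// ltW.
  apply: ae_imply2 (h_ge0 w wAC w0k wmono)
    (hcausal t0 w _ wc (C_loc_truncate B v vc) wv).
  by move=> t H1 H2 tt0; rewrite /= -H2// H1.
- move=> v vc v0.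
  have zc : C_loc (fun=> 0 : R) by move=> t; exact: cst_continuous.
  have zv t : t <= t0 -> 0 = truncate B v t.
    by move=> tt0; rewrite truncate_past// v0// clamp_id// lexx ltW.
  apply: ae_imply2 h_0 (hcausal t0 _ _ zc (C_loc_truncate B v vc) zv).
  by move=> t H1 H2 tt0; rewrite /= -H2// H1.
- exact: c_itv.
exists u; split => // tau t0tau uB s t st ttau.
rewrite ueq//; apply: (prim_causal h (truncate B u) u tau) => //.
  exact: C_loc_truncate.
move=> r rtau; apply: truncate_id => // q qr; apply: uB; exact: le_trans rtau.
Qed.

(** The a priori bounds B k up to time t0 + k + 1 do not depend on the level of
   truncation, provided it is at least B k. Hence the solutions truncated at
   increasing levels solve the genuine equation on larger and larger intervals
   and are bounded there independently of the level. *)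
Theorem global_existence : exists u : R -> R,
  [/\ C_loc u, u t0 = c, forall t, t <= t0 -> 0 <= u t <= kappa,
    forall s t, s <= t -> t <= t0 -> u s <= u t &
    forall s t, s <= t -> u t - u s = prim (h u) t - prim (h u) s].
Proof.
have k0 := kappa_gt0.
have t0n (n : nat) : t0 < t0 + n.+1%:R by rewrite ltrDl.
have [B HB] := choice (fun n : nat => @apriori_bound R h t0 kappa p Q hL hcausal
  kappa_gt0 pL Q_lim h_growth _ (t0n n)).
pose lev n := \sum_(i < n.+1) B i.
have Blev (k n : nat) : (k <= n)%N -> B k <= lev n.
  move=> kn; rewrite /lev (bigD1 (Ordinal (kn : (k < n.+1)%N)))//= lerDl.
  by apply: sumr_ge0 => i _; have [kB _] := HB i; exact: le_trans (ltW k0) kB.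
have klev n : kappa <= lev n.
  by apply: le_trans (Blev n n (leqnn n)); have [] := HB n.
have [u_ Hu] := choice (fun n => truncated_solution (lev n) (klev n)).
have uc n : C_loc (u_ n) by have [] := Hu n.
have ut0 n : u_ n t0 = c by have [] := Hu n.
have uinit n : initially_small t0 kappa (u_ n).
  have [_ uc0 u0 _ _] := Hu n; split; first by rewrite uc0; case/andP: c_itv.
  by move=> r /u0 /andP[r0 rk]; rewrite ger0_norm.
have ubound (k n : nat) : (k <= n)%N ->
    forall t, t <= t0 + k.+1%:R -> `|u_ n t| <= B k.
  move=> kn; have [_ Bk] := HB k; apply: Bk => //.
  by have [_ _ _ _] := Hu n; apply: solves_whileS; exact: Blev.
have dl01 (n : nat) : 0 <= (fun=> 0 : R) n <= 1 by rewrite lexx ler01.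
have approx k : exists g, L_loc g /\
    \forall n \near \oo, approximate_on h t0 u_ (fun=> 0) k n g.
  have [kB _] := HB k.
  have [g gL Hg] := h_dominated (B k) (lt_le_trans k0 kB).
  exists g; split => //; near=> n.
  have kn : (k <= n)%N by near: n; exact: nbhs_infty_ge.
  have kk : k%:R <= k.+1%:R :> R by rewrite ler_nat.
  split.
    (* u_ n is bounded by B k only up to t0 + k + 1; by causality it can be
       frozen after t0 + k. *)
    pose v := extend_right (t0 + k%:R) (u_ n).
    have vc : C_loc v by exact: C_loc_extend_right.
    have vB t : `|v t| <= B k.
      by apply: (ubound k n kn); rewrite ge_min lerD2l kk orbT.
    have uv t : t <= t0 + k%:R -> u_ n t = v t.
      by move=> tk; rewrite /v extend_rightE.
    apply: ae_imply2 (Hg v vc vB) (hcausal _ _ _ (uc n) vc uv) => t H1 H2 tk.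
    by rewrite H2.
  move=> s t _ st tk; rewrite !subr0.
  have [_ _ _ _ sol] := Hu n.
  apply: (sol (t0 + k%:R)) => //; first by rewrite lerDl.
  move=> r rk; apply: le_trans (ubound k n kn r _) (Blev _ _ kn).
  by apply: le_trans rk _; rewrite lerD2l.
have [U [UF ooU [u [ucont Uu ueq]]]] :=
  limit_of_approximations h t0 c u_ (fun=> 0) hL uc ut0 dl01 (cvg_cst _) approx.
exists u; split => //.
- apply: (cvg_unique (@Rhausdorff R) (Uu t0)).
  by rewrite (_ : u_^~ t0 = cst c); [exact: cvg_cst|apply/funext => n].
- move=> t tt0; apply/andP; split.
    apply: (cvgr_to_ge (Uu t)); apply: nearW => n.
    by have [_ _ H _ _] := Hu n; have /andP[] := H t tt0.
  apply: (cvgr_to_le (Uu t)); apply: nearW => n.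
  by have [_ _ H _ _] := Hu n; have /andP[] := H t tt0.
- move=> s t st tt0; apply: (ler_cvg_to (Uu s) (Uu t)); apply: nearW => n.
  by have [_ _ _ H _] := Hu n; exact: H.
Unshelve. all: by end_near. Qed.

End GlobalExistence.

(** * Integrals for the completed Lebesgue measure *)

Section CompletedMeasure.
Context {R : realType}.
Local Notation mu := (@lebesgue_measure R).
Local Notation cmu := (@completed_lebesgue_measure R).
Local Notation completedR := (caratheodory_type (wlength (@idfun R))^*%mu).

Lemma measurable_completed (A : set R) :
  measurable (A : set (measurableTypeR R)) -> measurable (A : set completedR).
Proof. exact: sub_caratheodory. Qed.

Lemma measurable_completed_id :
  measurable_fun [set: completedR] (fun x => x : measurableTypeR R).
Proof. by move=> _ A mA; rewrite setTI; exact: measurable_completed. Qed.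

(** The Lebesgue measure is the image of its completion by the identity. *)
Lemma ge0_integral_completed (A : set (measurableTypeR R)) (g : R -> \bar R) :
  measurable A -> measurable_fun A g -> (forall x, 0 <= g x)%E ->
  (\int[mu]_(x in A) g x = \int[cmu]_(x in A) g x)%E.
Proof.
move=> mA mg g0.
have := @ge0_integral_pushforward _ _ completedR (measurableTypeR R) R
  (fun x => x) measurable_completed_id cmu A g mA mg (fun x _ => g0 x).
move=> <-; apply: eq_measure_integral; first exact: measurable_completed_id.
by move=> mid B mB _.
Qed.

Lemma ae_completed (P : R -> Prop) :
  {ae mu, forall x, P x} -> {ae cmu, forall x, P x}.
Proof.
move=> [N [mN N0 PN]]; exists N; split => //.
exact: measurable_completed.
Qed.

(** Here g is Borel while G is only Lebesgue measurable. Comparing the positive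
   part of g with G stays within integrals of nonnegative functions. *)
Lemma le_Rintegral_completed (a b s t : R) (g : R -> R) (G : R -> R) :
  L_loc g -> a <= s -> t <= b -> cmu.-integrable `[a, b] (EFin \o G) ->
  (forall x, a <= x -> x <= b -> 0 <= G x) ->
  {ae mu, forall x, s <= x <= t -> g x <= G x} ->
  \int[mu]_(x in `[s, t]) g x <= \int[cmu]_(x in `[a, b]) G x.
Proof.
move=> gL as_ tb iG G0 gG.
have ig := L_loc_integrable g s t gL.
have mst : measurable (`[s, t]%classic : set completedR).
  by apply: measurable_completed; exact: measurable_itv.
have mab : measurable (`[a, b]%classic : set completedR).
  by apply: measurable_completed; exact: measurable_itv.
have stab : `[s, t]%classic `<=` `[a, b]%classic.
  move=> x; rewrite /= !in_itv /= => /andP[sx xt].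
  by rewrite (le_trans as_ sx) (le_trans xt tb).
have mG : measurable_fun (T := completedR) `[a, b] (EFin \o G).
  by case/integrableP : iG.
pose gp x := Num.max (g x) 0.
have mgp : measurable_fun (T := measurableTypeR R) `[s, t] (EFin \o gp).
  apply/measurable_EFinP; apply: measurable_maxr => //.
  by apply: measurable_funTS; exact: L_loc_measurable.
have mgp' : measurable_fun (T := completedR) `[s, t] (EFin \o gp).
  move=> mA B mB; apply: measurable_completed; exact: mgp.
have Ggp : (\int[mu]_(x in `[s, t]) (gp x)%:E <=
    \int[cmu]_(x in `[a, b]) (G x)%:E)%E.
  rewrite ge0_integral_completed//; last first.
    by move=> x; rewrite lee_fin le_max lexx orbT.
  apply: (@le_trans _ _ (\int[cmu]_(x in `[s, t]) (G x)%:E)%E).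
    apply: ae_ge0_le_integral => //.
    - by move=> x _; rewrite lee_fin le_max lexx orbT.
    - by move=> x /stab; rewrite /= in_itv /= lee_fin => /andP[]; exact: G0.
    - exact: measurable_funS mG.
    - move: gG => /ae_completed.
      apply: (@filterS _ _ (ae_filter_ringOfSetsType cmu)) => x Hx.
      rewrite /= in_itv /= => xst; rewrite lee_fin ge_max Hx//=.
      case/andP: xst => sx xt.
      by apply: G0; [exact: le_trans sx|exact: le_trans tb].
  apply: ge0_subset_integral => //.
  by move=> x; rewrite /= in_itv /= lee_fin => /andP[]; exact: G0.
have Gfin : (\int[cmu]_(x in `[a, b]) (G x)%:E)%E \is a fin_num.
  exact: integrable_fin_num.
rewrite -lee_fin [leRHS]fineK//; apply: le_trans Ggp.
rewrite fineK; last exact: integrable_fin_num.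
apply: le_integral => //.
  apply: le_integrable ig => // x _; rewrite /= lee_fin ler_norml.
  rewrite le_max ge_max lerNl -normrN ler_norm normrN ler_norm normr_ge0.
  by rewrite oppr_le0 normr_ge0 orbT.
by move=> x _; rewrite lee_fin le_max lexx.
Qed.

End CompletedMeasure.

(** * Positive linear operators and the existence theorem *)

Section PositiveOperators.
Context {R : realType}.
Local Notation mu := (@lebesgue_measure R).

Lemma L_locZ (k : R) g : L_loc g -> L_loc (fun t => k * g t).
Proof.
move=> gL; split; [|exact: openT|].
  by apply: measurable_funM => //; exact: L_loc_measurable.
move=> K KT cK.
have mK : measurable (K : set (measurableTypeR R)) by exact: compact_measurable.
have iK : mu.-integrable K (EFin \o g).
  have [mg _ ig] := gL; apply/integrableP; split; last exact: ig.
  by apply/measurable_EFinP; exact: measurable_funTS.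
by have /integrableP[] := integrableZl mK k iK.
Qed.

(** Both r + v and r - v are nonnegative. The latter is written as
   -2 v + (r + v), which gives l (r - v) = r l 1 - l v from the linearity
   relation without computing l 0. *)
Lemma positive_operator_le (l : (R -> R) -> R -> R) (r : R) v :
  linear_operator l -> positive_operator l -> C_loc v ->
  (forall t, `|v t| <= r) -> {ae mu, forall t, `|l v t| <= r * l (fun=> 1) t}.
Proof.
move=> ll lp vc vr.
have oc : C_loc (fun=> 1 : R) by move=> t; exact: cst_continuous.
pose w s := r * 1 + v s.
have wc : C_loc w by move=> t; apply: cvgD; [exact: cvg_cst|exact: vc].
pose w' s := - 2 * v s + w s.
have w'c : C_loc w'.
  by move=> t; apply: cvgD; [apply: cvgM; [exact: cvg_cst|exact: vc]|exact: wc].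
have w0 t : 0 <= w t by have := vr t; rewrite /w mulr1 ler_norml; lra.
have w'0 t : 0 <= w' t by have := vr t; rewrite /w' /w mulr1 ler_norml; lra.
have lw := ll r _ _ oc vc.
have lw' := ll (- 2) _ _ vc wc.
have lower : {ae mu, forall t, - (r * l (fun=> 1) t) <= l v t}.
  by apply: ae_imply2 lw (lp w wc w0) => t; rewrite -/w => -> ; lra.
have upper : {ae mu, forall t, l v t <= r * l (fun=> 1) t}.
  apply: ae_imply3 lw lw' (lp w' w'c w'0) => t E E'; rewrite /w' E' -/w => P.
  by move: P; rewrite E; lra.
by apply: ae_imply2 lower upper => t H H'; rewrite ler_norml H.
Qed.

End PositiveOperators.

Theorem theorem2p2 (R : realType) (l0 l1 f : (R -> R) -> R -> R)
  (l0_cont : continuous_operator l0) (l0_lin : linear_operator l0)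
  (l0_pos : positive_operator l0)
  (l1_cont : continuous_operator l1) (l1_lin : linear_operator l1)
  (l1_pos : positive_operator l1)
  (f_cont : continuous_operator f) (f_car : local_caratheodory f)
  (t0 : R)
  (l0V : V l0) (l1V : V l1) (fV : V f)
  (l01P : P_plus t0 (fun u t => l0 u t - l1 u t))
  (f0 : {ae (@lebesgue_measure R), forall t, t <= t0 -> f (fun=> 0) t = 0})
  (kappa : R) (kappa_gt0 : 0 < kappa)
  (f_ge0 : forall v, C_0 `[0, kappa] v ->
    {ae (@lebesgue_measure R), forall t, t <= t0 -> 0 <= f v t})
  (q : R -> R -> R) (qK : K_loc t0 q)
  (q_nondecreasing : forall t x y, t0 <= t -> 0 <= x -> x <= y ->
    q t x <= q t y)
  (q_lim : forall b, t0 < b ->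
    x^-1 * (\int[@completed_lebesgue_measure R]_(s in `[t0, b]) q s x)
      @[x --> +oo] --> (0 : R))
  (f_le : forall v, C_0 [set: R] v -> 0 <= v t0 <= kappa ->
    (forall t, t <= t0 -> - kappa <= v t <= kappa) ->
    {ae (@lebesgue_measure R), forall t, t0 <= t ->
      f v t * Num.sg (v t) <= q t (supnorm v)})
  (c : R) (c_itv : 0 <= c <= kappa) :
  exists u : R -> R,
    [/\ global_solution (fun u t => l0 u t - l1 u t + f u t) u,
        u t0 = c,
        forall t, t <= t0 -> 0 <= u t <= kappa &
        {ae (@lebesgue_measure R), forall t, t <= t0 -> 0 <= derive1 u t}].
Proof.
pose l u t := l0 u t - l1 u t.
pose h u t := l u t + f u t.
have lL : L1_continuous l.
  by apply: L1_continuousD; [|apply: L1_continuousN];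
    exact: continuous_operatorL1.
have fL : L1_continuous f by exact: continuous_operatorL1.
have hL : L1_continuous h by exact: L1_continuousD.
have lc : causal l.
  by apply: causalD; [|apply: causalN]; exact: V_causal.
have fc : causal f by exact: V_causal.
have hc : causal h by exact: causalD.
have oc : C_loc (fun=> 1 : R) by move=> t; exact: cst_continuous.
pose p t := l0 (fun=> 1) t + l1 (fun=> 1) t.
have pL : L_loc p by apply: L_locD; [exact: l0_cont.1|exact: l1_cont.1].
have l_le r v : C_loc v -> (forall t, `|v t| <= r) ->
    {ae (@lebesgue_measure R), forall t, `|l v t| <= r * p t}.
  move=> vc vr.
  apply: ae_imply2 (positive_operator_le _ _ _ l0_lin l0_pos vc vr)
    (positive_operator_le _ _ _ l1_lin l1_pos vc vr) => t H0 H1.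
  rewrite /p mulrDr; apply: le_trans (ler_normB _ _) _; exact: lerD.
have h_dom (r : R) : 0 < r -> exists2 g, L_loc g &
    forall v, C_loc v -> (forall t, `|v t| <= r) ->
      {ae (@lebesgue_measure R), forall t, `|h v t| <= g t}.
  move=> r0; have [g [gL g0 Hg]] := f_car r r0.
  exists (fun t => r * p t + g t); first by apply: L_locD => //; exact: L_locZ.
  move=> v vc vr; apply: ae_imply2 (l_le r v vc vr) (Hg v vc vr) => t H0 H1.
  by apply: le_trans (ler_normD _ _) _; exact: lerD.
have h_ge0 v : AC_loc setT v -> (forall t, 0 <= v t <= kappa) ->
    (forall s t, s <= t -> t <= t0 -> v s <= v t) ->
    {ae (@lebesgue_measure R), forall t, t <= t0 -> 0 <= h v t}.
  move=> vAC v0k vmono; have vc := AC_loc_continuous _ vAC.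
  have [_ _ H] := l01P.
  have {}H : {ae (@lebesgue_measure R), forall t, t <= t0 ->
      0 <= l (extend_right t0 v) t}.
    apply: H.
    - by move=> a b ab _; exact: vAC.
    - by move=> t _; have /andP[] := v0k t.
    - by move=> s t; rewrite !in_itv /= => _ tt0 st; exact: vmono.
  have E := lc t0 v _ vc (C_loc_extend_right t0 v vc)
    (fun t tt0 => esym (extend_rightE t0 v t tt0)).
  have v0 : C_0 `[0, kappa] v.
    split => //.
    exists kappa; split; first exact: num_real.
    move=> M kM t _; have /andP[h0 hk] := v0k t.
    by rewrite /= ger0_norm// (le_trans hk)// ltW.
  apply: ae_imply3 H E (f_ge0 v v0) => t H E F tt0.
  by rewrite /h addr_ge0 ?E ?H ?F.
have h_0 : {ae (@lebesgue_measure R), forall t, t <= t0 -> h (fun=> 0) t = 0}.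
  have zc : C_loc (fun=> 0 : R) by move=> t; exact: cst_continuous.
  have z0 (t : R) : `|(fun=> 0 : R) t| <= 0 by rewrite normr0.
  apply: ae_imply2 (l_le 0 _ zc z0) f0 => t.
  rewrite mul0r normr_le0 => /eqP H F tt0.
  by rewrite /h H F// addr0.
pose Q b x := \int[@completed_lebesgue_measure R]_(s in `[t0, b]) q s x.
have [q0 _ _ qint] := qK.
have qi b x : 0 <= x -> t0 <= b ->
    (@completed_lebesgue_measure R).-integrable `[t0, b] (EFin \o q ^~ x).
  move=> x0 tb; have := qint [set x] (@compact_set1 _ x) _ _ t0 b (lexx _) tb.
  rewrite (_ : (fun t => _) = EFin \o q^~ x); last first.
    by apply/funext => t; rewrite image_set1 ereal_sup1.
  by apply; [exists x|move=> _ ->; rewrite /= in_itv /= andbT].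
have h_growth e v x s t b : `|e| = 1 -> C_loc v ->
  (forall r, `|v r| <= x) -> initially_small t0 kappa v ->
  t0 <= s -> s <= t -> t <= b -> t0 < b ->
  (forall r, s <= r -> r <= t -> 0 < e * v r) ->
  e * (prim (h v) t - prim (h v) s) <= x * (prim p t - prim p s) + Q b x.
  move=> e1 vc vx [v0 vk] t0s st tb t0b pos.
  have x0 : 0 <= x by apply: le_trans (vx 0).
  have lvL : L_loc (l v) by exact: lL.1.
  have fvL : L_loc (f v) by exact: fL.1.
  have xpL : L_loc (fun r => x * p r) by exact: L_locZ.
  have efL : L_loc (fun r => e * f v r) by exact: L_locZ.
  have -> : prim (h v) t - prim (h v) s =
      (prim (l v) t - prim (l v) s) +
      \int[@lebesgue_measure R]_(r in `[s, t]) f v r.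
    rewrite !prim_diff//; last exact: hL.1.
    by rewrite -RintegralD//; exact: L_loc_integrable.
  rewrite mulrDr; apply: lerD.
    apply: le_trans (ler_norm _) _; rewrite normrM e1 mul1r.
    apply: le_trans (prim_norm _ _ s t lvL xpL st _) _.
      by apply: ae_imply (l_le x v vc vx) => r + _; apply.
    rewrite !prim_diff// RintegralZl//; exact: L_loc_integrable.
  rewrite -RintegralZl//; last exact: L_loc_integrable.
  apply: le_Rintegral_completed => //.
  - by apply: qi => //; exact: ltW.
  - by move=> r t0r _; exact: q0.
  have vC0 : C_0 [set: R] v.
    split => //; exists x; split; first exact: num_real.
    by move=> M xM r _; rewrite /= (le_trans (vx r))// ltW.
  have v0k : 0 <= v t0 <= kappa.
    by rewrite v0/=; apply: le_trans (ler_norm _) (vk _ _).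
  have vk' r : r <= t0 -> - kappa <= v r <= kappa.
    by rewrite -ler_norml; exact: vk.
  have vub : has_ubound [set `|v r| | r in [set: R]] by exists x => _ [r _ <-].
  have supx : supnorm v <= x.
    by apply: ge_sup; [exists `|v 0|; exists 0|move=> _ [r _ <-]].
  have sup0 : 0 <= supnorm v.
    by apply: le_trans (normr_ge0 (v 0)) _; apply: ub_le_sup => //; exists 0.
  apply: ae_imply (f_le v vC0 v0k vk') => r Hr /andP[sr rt].
  have t0r : t0 <= r by exact: le_trans sr.
  apply: le_trans (q_nondecreasing r _ _ t0r sup0 supx).
  apply: le_trans (Hr t0r); rewrite mulrC.
  (* Since e v > 0 on [s, t], e f(v) is f(v) sgn v. *)
  suff -> : e = Num.sg (v r) by [].
  have := pos r sr rt.
  have [vp|vn|->] := ltrgt0P (v r); last by rewrite mulr0 ltxx.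
    by rewrite pmulr_lgt0// gtr0_sg// => e0; rewrite -e1 gtr0_norm.
  by rewrite nmulr_lgt0// ltr0_sg// => e0; rewrite -e1 ltr0_norm// opprK.
have [u [uc ut0 u0k umono ueq]] := global_existence h t0 kappa c p Q hL hc
  h_dom h_ge0 h_0 kappa_gt0 c_itv pL q_lim h_growth.
have huL : L_loc (h u) by exact: hL.1.
have uAC : AC_loc setT u.
  apply: (AC_loc_dominated _ _ _ id (AC_prim _ huL)) => //.
  by move=> s t st; rewrite ueq.
have uder : {ae (@lebesgue_measure R), forall t,
    derivable u t 1 /\ derive1 u t = h u t}.
  have uE : u = prim (h u) + cst (u 0 - prim (h u) 0).
    apply/funext => t; change (u t = prim (h u) t + (u 0 - prim (h u) 0)).
    have [t0'|t0'] := leP 0 t; first by have := ueq 0 t t0'; lra.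
    by have := ueq t 0 (ltW t0'); lra.
  apply: ae_imply (prim_derive _ huL) => t [dP P'].
  have HP : is_derive t 1 (prim (h u)) (h u t).
    by apply: DeriveDef => //; rewrite -derive1E.
  have := is_deriveD HP (is_derive_cst (u 0 - prim (h u) 0) t 1).
  rewrite -uE addr0 => D; split; first exact: ex_derive.
  by rewrite derive1E; exact: derive_val.
exists u; split => //.
(* The derivative is h u, which is nonnegative on the past of t0 because u can
   be frozen after t0. *)
pose v := extend_right t0 u.
have vc : C_loc v by exact: C_loc_extend_right.
have vAC : AC_loc setT v.
  apply: (AC_loc_dominated _ _ _ (fun t => Num.min t t0) uAC) => //.
  move=> s t st; split; first by rewrite le_min !ge_min lexx st orbT.
  by have [] := leP t t0; have [] := leP s t0; lra.
have v0k t : 0 <= v t <= kappa by apply: u0k; rewrite ge_min lexx orbT.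
have vmono s t : s <= t -> t <= t0 -> v s <= v t.
  move=> st tt0; rewrite /v !extend_rightE//; first exact: umono.
  exact: le_trans tt0.
have uv t : t <= t0 -> u t = v t by move=> tt0; rewrite /v extend_rightE.
apply: ae_imply3 uder (h_ge0 v vAC v0k vmono) (hc t0 _ _ uc vc uv).
move=> t [_ ->] H E tt0.
by rewrite E ?H.
Qed.
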